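(* Let $\Gamma$ be a metric graph (not reduced to a single point) and let $G=(V,E)$ be a simple graph model of $\Gamma$. The divisorial gonality of $\Gamma$ satisfies $$\gamma_{\mathrm{div}}(\Gamma)\ \geq\ \frac{|V|\,\lambda_1(G)}{24\,d_{\max}},$$ where $\lambda_1(G)$ is the smallest non-trivial eigenvalue of the discrete Laplacian of $G$ and $d_{\max}$ is the maximum valence of points of $\Gamma$.
   Context: Metric graphs. A metric graph $\Gamma$ is a compact connected metric space such that every point $p\in\Gamma$ has a neighbourhood isometric to a star $\{t e^{2\pi i m/n} : 0\le t<r,\ 1\le m\le n\}\subset\mathbb{C}$ with its path metric, for some $r>0$ and some integer $n\ge 0$ (for $n=0$ the star is a point); $n=\mathrm{val}(p)$ is the valence of $p$. A vertex set of $\Gamma$ is a finite non-empty set $V\subset\Gamma$ containing all points of valence different from $2$; the edges are the closures of the connected components of $\Gamma\setminus V$. The resulting graph $G=(V,E)$ is a model of $\Gamma$; it is simple if it has no loops and no multiple edges. $d_{\max}=\max_{p\in\Gamma}\mathrm{val}(p)$. Divisorial gonality. $\mathrm{Div}(\Gamma)$ is the free abelian group on the points of $\Gamma$; the degree of $D=\sum_v a_v (v)$ is $\sum_v a_v$, and $D$ is effective ($D\ge 0$) if all $a_v\ge 0$. A rational function on $\Gamma$ is a continuous piecewise linear function $f:\Gamma\to\mathbb{R}$ with integer slopes; $\mathrm{ord}_p(f)$ is the sum of the outgoing slopes of $f$ at $p$, and $\mathrm{div}(f)=\sum_p\mathrm{ord}_p(f)(p)$. $D\sim D'$ if $D-D'=\mathrm{div}(f)$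 for some rational function $f$. Set $|D|=\{E\ge 0: E\sim D\}$. The rank of $D$ is $r(D)=\min\{\deg(E): E\geq 0,\ |D-E|=\emptyset\}-1$. The divisorial gonality $\gamma_{\mathrm{div}}(\Gamma)$ is the smallest integer $d$ for which there is a divisor $D$ on $\Gamma$ with $\deg(D)=d$ and $r(D)=1$. Discrete Laplacian. For $f:V\to\mathbb{R}$, $L_G(f)(v)=\sum_{u\sim v}(f(v)-f(u))$, the sum being over vertices $u$ adjacent to $v$ in $G$ (edge lengths are ignored). $\lambda_1(G)$ is the smallest non-zero eigenvalue of $L_G$. *)

(* Defs.v *)
From HB Require Import structures.
From mathcomp Require Import all_boot all_order all_algebra finmap.
From mathcomp Require Import all_classical all_reals all_analysis.
From mathcomp Require Import freeg.

Set Implicit Arguments.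
Unset Strict Implicit.
Unset Printing Implicit Defensive.

Import Order.TTheory GRing.Theory Num.Theory.
Import numFieldNormedType.Exports.

Local Open Scope classical_set_scope.
Local Open Scope ring_scope.

(* Least and greatest elements; the default [x0] is only returned when there
   is none. *)
Definition minimum d (T : porderType d) (x0 : T) (A : set T) : T :=
  xget x0 (A `&` lbound A).

Definition maximum d (T : porderType d) (x0 : T) (A : set T) : T :=
  xget x0 (A `&` ubound A).

Section MetricGraph.
Context {R : realType} {Gamma : metricType R}.
Implicit Types (p u v : Gamma) (f : Gamma -> R) (V : {fset Gamma})
  (D E : {freeg Gamma}).

(* Path metric of the star with n rays: (i, s) is the point at distance s from
   the centre on the ray i, and all the (i, 0) denote the centre. *)
Definition star_dist n (x y : 'I_n * R) : R :=
  if x.1 == y.1 then `|x.2 - y.2| else x.2 + y.2.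

(* [phi] is an isometry from the half-open star with n rays of length r onto a
   neighbourhood of [p], and sends the centre to [p]. The singleton [set p]
   matters only for n = 0, when the star is a point. *)
Definition star_chart p n (r : R) (phi : 'I_n -> R -> Gamma) : Prop :=
  [/\ 0 < r,
      forall i, phi i 0 = p,
      forall i j s t, 0 <= s < r -> 0 <= t < r ->
        mdist (phi i s) (phi j t) = star_dist (i, s) (j, t)
    & nbhs p (p |` [set q | exists i t, 0 <= t < r /\ q = phi i t])].

Definition valence p : nat :=
  xget 0%N [set n | exists r (phi : 'I_n -> R -> Gamma), star_chart p r phi].

(* f is affine on each ray of the star, with outgoing slopes m. *)
Definition outgoing_slopes f p n (r : R) (phi : 'I_n -> R -> Gamma)
    (m : 'I_n -> int) : Prop :=
  forall i t, 0 <= t < r -> f (phi i t) = f p + (m i)%:~R * t.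

(* Piecewise linearity is stated locally; since Gamma is compact, this amounts
   to finitely many linear pieces. *)
Definition rational_function f : Prop :=
  continuous f /\
  forall p, exists n r (phi : 'I_n -> R -> Gamma) (m : 'I_n -> int),
    star_chart p r phi /\ outgoing_slopes f p r phi m.

Definition ord f p : int :=
  xget 0 [set k | exists n r (phi : 'I_n -> R -> Gamma) (m : 'I_n -> int),
    [/\ star_chart p r phi, outgoing_slopes f p r phi m & k = \sum_i m i]].

Definition principal_div f : {freeg Gamma} :=
  \sum_(p \in [set: Gamma]) << ord f p *g p >>.

Definition effective D : Prop := fgle 0 D.

Definition linearly_equivalent D D' : Prop :=
  exists2 f, rational_function f & D - D' = principal_div f.

Definition linear_system D : set {freeg Gamma} :=
  [set E | effective E /\ linearly_equivalent E D].

Definition rank D : int :=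
  minimum 0 [set deg E | E in
    [set E | effective E /\ linear_system (D - E) = set0]] - 1.

Definition vertex_set V : Prop :=
  V != fset0 /\ forall p, valence p != 2%N -> p \in V.

Definition edges V : set (set Gamma) :=
  [set closure (connected_component (~` [set` V]) x) | x in ~` [set` V]].

(* The open edges avoid V, so the vertices lying on an edge are its ends. *)
Definition edge_ends V (e : set Gamma) : set Gamma := e `&` [set` V].

Definition is_loop V (e : set Gamma) : Prop :=
  exists v, edge_ends V e = [set v].

Definition simple_model V : Prop :=
  (forall e, edges V e -> ~ is_loop V e) /\
  (forall e e', edges V e -> edges V e' ->
    edge_ends V e = edge_ends V e' -> e = e').

Definition adjacent V u v : Prop :=
  u <> v /\ exists2 e, edges V e & edge_ends V e = [set u; v].

(* Functions take values in the regular module R^o so that they form a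
   finite-dimensional vector space over R. *)
Definition laplacian V (f : {ffun V -> R^o}) : {ffun V -> R^o} :=
  [ffun v => \sum_(u : V | `[< adjacent V (val v) (val u) >]) (f v - f u)].

Lemma laplacian_is_linear V : linear (@laplacian V).
Proof.
move=> a f g; apply/ffunP => v; rewrite !ffunE scaler_sumr -big_split/=.
by apply: eq_bigr => u _; rewrite !ffunE scalerBr opprD addrACA.
Qed.

HB.instance Definition _ V :=
  GRing.isLinear.Build R {ffun V -> R^o} {ffun V -> R^o} _
    (@laplacian V) (@laplacian_is_linear V).

Definition lambda1 V : R :=
  minimum 0 [set a | a != 0 /\ passmx.leigenvalue (linfun (@laplacian V)) a].

End MetricGraph.

Section MetricGraphInvariants.
Context {R : realType} (Gamma : metricType R).

Definition metric_graph : Prop :=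
  [/\ compact [set: Gamma], connected [set: Gamma]
    & forall p : Gamma, exists n r (phi : 'I_n -> R -> Gamma),
        star_chart p r phi].

Definition max_valence : nat := maximum 0%N (range (@valence R Gamma)).

Definition div_gonality : int :=
  minimum 0 [set deg D | D in [set D : {freeg Gamma} | rank D = 1]].

End MetricGraphInvariants.

(* Main.v *)
Require Import Defs.
From mathcomp Require Import all_boot all_order all_algebra finmap.
From mathcomp Require Import all_classical all_reals all_analysis.
From mathcomp Require Import freeg lra ring zify.

(** Write n for the number of vertices, gamma for the gonality and d_max for
    the maximum valence. The proof finds a small set of points of Gamma whose
    removal leaves no large piece of the graph, and then plays that separator
    against the spectral gap.

    The separator is the support of a divisor. Let D0 be a divisor of rank one
    and degree gamma. Some effective divisor D equivalent to D0 is balanced: no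
    component of Gamma minus the support of D contains more than n / 2 vertices
    ([balanced_divisor]). Suppose not, so that every effective divisor in the
    class has one large component, and choose D so that its large component C
    has as few vertices as possible. As D0 has rank one, there is an effective
    E = D + div f with a chip at a given vertex x of C. Let c be a median of the
    values of f at the vertices. Going from D to E only where f is above c, that
    is, adding div (max (f, c)) to D, gives an effective divisor D_c whose chips
    separate the sets {f < c}, {f = c} and {f > c} from each other
    ([connected_off_level]). The first and the last contain at most n / 2
    vertices, so the large component of D_c lies in {f = c}. There D, D_c and E
    agree, hence the large component of D_c is contained in C; by minimality it
    contains the vertex x, and E has no chip at x, a contradiction.

    A balanced divisor of degree gamma gives the bound as follows. If its
    support contains at least n / 12 vertices, then gamma >= n / 12 and the
    estimate lambda_1 <= 2 d_max suffices ([lambda1_le_max_valence]). Otherwise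
    the components can be grouped into two classes of vertices A and B, each
    with at least n / 4 elements ([balanced_union]). An edge whose end points are
    not in the same component meets the support, and a point of the support is
    met by at most d_max edges, so at most gamma d_max edges leave A or B
    ([sum_crossing]). The function of mean zero that is constant on A, constant
    on B and zero on the support has small energy, and the variational
    characterisation of lambda_1 ([lambda1_rayleigh]) concludes.

    Three facts on metric graphs are needed. A principal divisor has degree
    zero ([deg_principal_div0]); an edge has exactly two ends, so that the graph
    is connected and the kernel of its Laplacian consists of the constants
    ([closure_ends_uniq], [adjacent_connected]); and divisors of rank one exist,
    so that the gonality is the degree of one of them
    ([div_gonality_attained]). The first two rest on a subdivision of Gamma into
    finitely many isometric segments ([subdivision]) and on the involution that
    exchanges the two ends of a segment. A rational function has opposite slopes
    at these two ends, whence the degree zero. Composing the involution with the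
    crossing of points of valence two walks along an edge, and an orbit of such
    a composite of two involutions contains at most two dead ends
    ([orbit_fixed_uniq]). *)

Set Implicit Arguments.
Unset Strict Implicit.
Unset Printing Implicit Defensive.

Import Order.TTheory GRing.Theory Num.Theory.
Import numFieldNormedType.Exports.

Local Open Scope classical_set_scope.
Local Open Scope ring_scope.

(** * Star charts *)

Lemma pos_lt_both (R : realFieldType) (a b : R) : 0 < a -> 0 < b ->
  exists c, [/\ 0 < c, c < a & c < b].
Proof.
move=> a0 b0; exists (Num.min a b / 2).
have : 0 < Num.min a b by rewrite lt_min a0.
have : Num.min a b <= a by rewrite ge_min lexx.
have : Num.min a b <= b by rewrite ge_min lexx orbT.
by split; lra.
Qed.

Section Charts.
Context {R : realType} {Gamma : metricType R}.
Implicit Types (p q : Gamma) (f g : Gamma -> R) (r e s t : R).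

(** The image of a star chart may miss points that are closer to [p] than
    the radius of the chart. Here it is the whole ball, so a point near [p] lies
    on a ray, at a parameter equal to its distance to [p]. *)
Definition ball_chart p n (r : R) (phi : 'I_n -> R -> Gamma) : Prop :=
  star_chart p r phi /\
  forall q, mdist p q < r -> q <> p -> exists i t, 0 < t < r /\ q = phi i t.

Lemma star_dist_from0 n (i j : 'I_n) (t : R) :
  0 <= t -> star_dist (i, 0) (j, t) = t.
Proof.
by move=> t0; rewrite /star_dist/=; case: eqP => _; rewrite ?sub0r ?normrN ?ger0_norm ?add0r.
Qed.

Lemma star_chart_dist p n r (phi : 'I_n -> R -> Gamma) i t :
  star_chart p r phi -> 0 <= t < r -> mdist p (phi i t) = t.
Proof.
move=> [r0 phi0 phid _] tr; rewrite -{1}(phi0 i) phid ?lexx ?r0//.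
by rewrite star_dist_from0//; case/andP: tr.
Qed.

Lemma nbhs_mdist p (A : set Gamma) :
  nbhs p A <-> exists2 e, 0 < e & forall q, mdist p q < e -> A q.
Proof.
rewrite -metricType_numDomainType.nbhs_nbhs_mdist; split.
  by move=> [e /= e0 eA]; exists e.
by move=> [e /= e0 eA]; exists e.
Qed.

Lemma star_chart_shrink p n (r r' : R) (phi : 'I_n -> R -> Gamma) :
  star_chart p r phi -> 0 < r' <= r -> star_chart p r' phi.
Proof.
move=> cp /andP[r'0 r'r]; have [r0 phi0 phid pnbhs] := cp; split=> //.
  move=> i j s t /andP[s0 sr] /andP[t0 tr].
  by apply: phid; rewrite ?s0 ?t0/=; [exact: lt_le_trans sr r'r|exact: lt_le_trans tr r'r].
apply/nbhs_mdist; move/nbhs_mdist: pnbhs => [e e0 eA].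
exists (Num.min e r'); first by rewrite lt_min e0.
move=> q; rewrite lt_min => /andP[qe qr'].
have [->|[i [t [tr qE]]]] := eA _ qe; first by left.
right; exists i, t; split=> //; case/andP: (tr) => -> _ /=.
by move: qr'; rewrite qE (star_chart_dist _ cp).
Qed.

Lemma ball_chart_shrink p n (r r' : R) (phi : 'I_n -> R -> Gamma) :
  ball_chart p r phi -> 0 < r' <= r -> ball_chart p r' phi.
Proof.
move=> [cp pin] r'r; split; first exact: star_chart_shrink cp r'r.
move=> q qr' qp; case/andP: r'r => r'0 r'r.
have [i [t [/andP[t0 tr] qE]]] := pin _ (lt_le_trans qr' r'r) qp.
exists i, t; split => //; rewrite t0/=.
by move: qr'; rewrite qE (star_chart_dist _ cp)// (ltW t0).
Qed.

Lemma star_chart_ball p n r (phi : 'I_n -> R -> Gamma) :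
  star_chart p r phi -> exists2 r', 0 < r' <= r & ball_chart p r' phi.
Proof.
move=> cp; have [r0 _ _ /nbhs_mdist[e e0 eA]] := cp.
have mr : 0 < Num.min e r <= r by rewrite lt_min e0 r0 ge_min lexx orbT.
exists (Num.min e r) => //; split; first exact: star_chart_shrink cp mr.
move=> q; rewrite lt_min => /andP[qe qr] qp.
have [//|[i [t [/andP[t0 tr] qE]]]] := eA _ qe.
have dt : mdist p q = t by rewrite qE (star_chart_dist _ cp)// t0 tr.
exists i, t; split => //; rewrite lt_neqAle t0 andbT; apply/andP; split.
  by apply/eqP => t00; apply: qp; apply/esym/(@mdist_positivity R); rewrite dt.
by rewrite lt_min -dt qe qr.
Qed.

Lemma ball_chart_uniq p n r (phi : 'I_n -> R -> Gamma) i j s t :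
  star_chart p r phi -> 0 < s < r -> 0 < t < r -> phi i s = phi j t ->
  i = j /\ s = t.
Proof.
move=> [r0 phi0 phid _] /andP[s0 sr] /andP[t0 tr] e.
have := phid i j s t; rewrite e mdistxx (ltW s0) (ltW t0) sr tr.
move=> /(_ isT isT); rewrite /star_dist/=.
case: eqP => [-> /esym/eqP|_]; last by move=> ?; exfalso; lra.
by rewrite normr_eq0 subr_eq0 => /eqP ->.
Qed.

(** Two points on different rays, at distances s and t from the centre, are at
    distance s + t and not |s - t|; so a geodesic that starts at the centre stays
    on the ray on which it started. *)
Lemma geodesic_ray p n r e (phi : 'I_n -> R -> Gamma) (gamma : R -> Gamma) :
  ball_chart p r phi -> 0 < e -> e <= r -> gamma 0 = p ->
  (forall s t, 0 <= s < e -> 0 <= t < e -> mdist (gamma s) (gamma t) = `|s - t|) ->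
  exists i, forall t, 0 <= t < e -> gamma t = phi i t.
Proof.
move=> cp e0 er gamma0 iso; have [_ phi0 phid _] := cp.1.
have on_ray t : 0 < t < e -> exists i, gamma t = phi i t.
  move=> /andP[t0 te].
  have dt : mdist p (gamma t) = t.
    by rewrite -gamma0 iso ?lexx ?e0 ?te ?(ltW t0)// sub0r normrN gtr0_norm.
  case: (cp.2 (gamma t)) => [||i [s [/andP[s0 sr] gE]]].
  - by rewrite dt; lra.
  - by move=> g; move: dt t0; rewrite g mdistxx => ->; rewrite ltxx.
  - exists i; rewrite gE; congr phi; rewrite -dt gE.
    by rewrite (star_chart_dist _ cp.1)// (ltW s0) sr.
have he : 0 < e / 2 < e by lra.
have [i ei] := on_ray _ he.
exists i => t /andP[]; rewrite le_eqVlt => /predU1P[<- _|t0 te].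
  by rewrite phi0.
have [|j ej] := on_ray t; first by rewrite t0.
case: (j =P i) => [<-//|ji].
have := iso t (e / 2); rewrite ei ej phid; [|lra|lra].
rewrite /star_dist/=; case: eqP => // _ /(_ ltac:(lra) ltac:(lra)).
by case: (ger0P (t - e / 2)) => ? ?; exfalso; lra.
Qed.

Lemma ray_match p n n' r (phi : 'I_n -> R -> Gamma) (psi : 'I_n' -> R -> Gamma) :
  ball_chart p r phi -> ball_chart p r psi ->
  forall i, exists j, forall t, 0 <= t < r -> phi i t = psi j t.
Proof.
move=> cphi cpsi i; have [r0 phi0 phid _] := cphi.1.
apply: (geodesic_ray cpsi r0 (lexx r) (phi0 i)) => s t sr tr.
by rewrite phid// /star_dist eqxx.
Qed.

Lemma ball_chart_min p n n' (r r' : R) (phi : 'I_n -> R -> Gamma) (psi : 'I_n' -> R -> Gamma) :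
  star_chart p r phi -> star_chart p r' psi ->
  exists2 e, 0 < e /\ e <= r /\ e <= r' & ball_chart p e phi /\ ball_chart p e psi.
Proof.
move=> /star_chart_ball[e /andP[e0 er] ce] /star_chart_ball[e' /andP[e'0 er'] ce'].
have h : 0 < Num.min e e' <= e by rewrite lt_min e0 e'0 ge_min lexx.
have h' : 0 < Num.min e e' <= e' by rewrite lt_min e0 e'0 ge_min lexx orbT.
exists (Num.min e e'); last first.
  by split; [exact: ball_chart_shrink ce _|exact: ball_chart_shrink ce' _].
split; first by case/andP: h.
by split; [apply: le_trans er|apply: le_trans er']; case/andP: h; case/andP: h'.
Qed.

(** Hence any two charts at [p] have the same rays near [p], up to their
    numbering: neither the valence nor the order of a function depends on the
    chart. *)
Lemma ray_match_inj p n n' r (phi : 'I_n -> R -> Gamma) (psi : 'I_n' -> R -> Gamma) :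
  ball_chart p r phi -> ball_chart p r psi ->
  exists2 h : 'I_n -> 'I_n', injective h &
    forall i t, 0 <= t < r -> phi i t = psi (h i) t.
Proof.
move=> cphi cpsi.
have /choice[h hE] := ray_match cphi cpsi.
exists h => // i j hij.
have [[r0 _ _ _] _] := cphi.
have hr : 0 < r / 2 < r by lra.
apply: (ball_chart_uniq cphi.1 hr hr _).1.
by rewrite !hE ?hij//; lra.
Qed.

Lemma star_chart_card p n n' (r r' : R) (phi : 'I_n -> R -> Gamma) (psi : 'I_n' -> R -> Gamma) :
  star_chart p r phi -> star_chart p r' psi -> n = n'.
Proof.
move=> cphi cpsi; have [e _ [ce ce']] := ball_chart_min cphi cpsi.
have [h /leq_card] := ray_match_inj ce ce'; have [h' /leq_card] := ray_match_inj ce' ce.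
by rewrite !card_ord => ? _ ? _; apply/eqP; rewrite eqn_leq; apply/andP.
Qed.

Lemma valenceE p n r (phi : 'I_n -> R -> Gamma) :
  star_chart p r phi -> valence p = n.
Proof.
move=> cphi; apply: xget_unique; first by exists r, phi.
by move=> n' [r' [psi cpsi]]; exact: star_chart_card cpsi cphi.
Qed.

Lemma outgoing_slopes_shrink f p n (r r' : R) (phi : 'I_n -> R -> Gamma) m :
  outgoing_slopes f p r phi m -> r' <= r -> outgoing_slopes f p r' phi m.
Proof.
by move=> fm r'r i t /andP[t0 tr]; apply: fm; rewrite t0 (lt_le_trans tr).
Qed.

Lemma slopes_transport f p n n' (r r' : R) (phi : 'I_n -> R -> Gamma)
    (psi : 'I_n' -> R -> Gamma) m :
  star_chart p r phi -> star_chart p r' psi -> outgoing_slopes f p r phi m ->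
  exists2 h : 'I_n' -> 'I_n, bijective h &
    exists2 e, 0 < e <= r' & outgoing_slopes f p e psi (m \o h).
Proof.
move=> cphi cpsi fm; have [e [e0 [er er']] [ce ce']] := ball_chart_min cphi cpsi.
have [h hinj hE] := ray_match_inj ce' ce.
have nn' := star_chart_card cphi cpsi.
exists h; first by apply: inj_card_bij => //; rewrite !card_ord nn'.
exists e; first by rewrite e0.
by move=> i t te; rewrite hE//; apply: (outgoing_slopes_shrink fm er).
Qed.

Lemma slopes_uniq f p n r (phi : 'I_n -> R -> Gamma) m m' :
  0 < r -> outgoing_slopes f p r phi m -> outgoing_slopes f p r phi m' -> m =1 m'.
Proof.
move=> r0 fm fm' i.
have hr : 0 <= r / 2 < r by lra.
have := fm i _ hr; rewrite (fm' i _ hr) => /addrI.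
have r2 : r / 2 != 0 by lra.
by move=> /(mulIf r2) /eqP; rewrite eqr_int => /eqP.
Qed.

Lemma ordE f p n r (phi : 'I_n -> R -> Gamma) m :
  star_chart p r phi -> outgoing_slopes f p r phi m -> ord f p = \sum_i m i.
Proof.
move=> cphi fm; apply: xget_unique; first by exists n, r, phi, m.
move=> k [n' [r' [psi [m' [cpsi fm' ->]]]]].
have [h hbij [e /andP[e0 er'] fmh]] := slopes_transport cphi cpsi fm.
rewrite (reindex h) /=; last by case: hbij => h' ? ?; exists h' => ? _.
apply: eq_bigr => i _; apply/esym.
by apply: (slopes_uniq e0 fmh); exact: outgoing_slopes_shrink fm' er'.
Qed.

Lemma rational_slopes f p n r (phi : 'I_n -> R -> Gamma) :
  rational_function f -> star_chart p r phi ->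
  exists e m, [/\ 0 < e <= r & outgoing_slopes f p e phi m].
Proof.
move=> [_ /(_ p)[n' [r' [psi [m [cpsi fm]]]]]] cphi.
have [h _ [e er fmh]] := slopes_transport cpsi cphi fm.
by exists e, (m \o h).
Qed.

End Charts.

(** * Rational functions and their orders *)

Section RationalFunctions.
Context {R : realType} {Gamma : metricType R}.
Implicit Types (p q : Gamma) (f g : Gamma -> R) (r e s t c : R).

Lemma continuous_mdistP f : continuous f <->
  forall p e, 0 < e -> exists2 d, 0 < d & forall q, mdist p q < d -> `|f p - f q| < e.
Proof.
split=> [cf p e e0|fP p].
  have /cvgrPdist_lt/(_ e e0) := cf p.
  by rewrite /prop_near1 /= => /nbhs_mdist.
apply/cvgrPdist_lt => e e0; have [d d0 dP] := fP p e e0.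
by apply/nbhs_mdist; exists d.
Qed.

Lemma rational_function_cst c :
  (forall p, exists n r (phi : 'I_n -> R -> Gamma), star_chart p r phi) ->
  rational_function (fun _ : Gamma => c).
Proof.
move=> charts; split; first by move=> p; exact: cvg_cst.
move=> p; have [n [r [phi cp]]] := charts p; exists n, r, phi, (fun=> 0).
by split=> // i t _; rewrite mul0r addr0.
Qed.

Lemma ord_slopes f p : rational_function f ->
  exists n r (phi : 'I_n -> R -> Gamma) m,
    [/\ ball_chart p r phi, outgoing_slopes f p r phi m & ord f p = \sum_i m i].
Proof.
move=> [_ /(_ p)[n [r [phi [m [cp fm]]]]]].
have [r' /andP[r'0 r'r] cp'] := star_chart_ball cp.
have fm' := outgoing_slopes_shrink fm r'r.
by exists n, r', phi, m; split=> //; exact: ordE cp'.1 fm'.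
Qed.

Lemma common_slopes f g p : rational_function f -> rational_function g ->
  exists n r (phi : 'I_n -> R -> Gamma) m k,
    [/\ star_chart p r phi, outgoing_slopes f p r phi m & outgoing_slopes g p r phi k].
Proof.
move=> [_ /(_ p)[n [r [phi [m [cp fm]]]]]] gP.
have [e [k [er gk]]] := rational_slopes gP cp.
exists n, e, phi, m, k; split=> //; first exact: star_chart_shrink cp er.
by apply: outgoing_slopes_shrink fm _; case/andP: er.
Qed.

Lemma slopesD f g p n r (phi : 'I_n -> R -> Gamma) m k :
  outgoing_slopes f p r phi m -> outgoing_slopes g p r phi k ->
  outgoing_slopes (f \+ g) p r phi (fun i => m i + k i).
Proof.
move=> fm gk i t tr /=; rewrite fm// gk// intrD mulrDl.
by rewrite addrACA.
Qed.

Lemma slopesN f p n r (phi : 'I_n -> R -> Gamma) m :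
  outgoing_slopes f p r phi m -> outgoing_slopes (\- f) p r phi (fun i => - m i).
Proof. by move=> fm i t tr /=; rewrite fm// opprD intrN mulNr. Qed.

Lemma rational_functionD f g :
  rational_function f -> rational_function g -> rational_function (f \+ g).
Proof.
move=> fR gR; split; first by move=> p; apply: cvgD; [exact: fR.1|exact: gR.1].
move=> p; have [n [r [phi [m [k [cp fm gk]]]]]] := common_slopes p fR gR.
by exists n, r, phi, (fun i => m i + k i); split=> //; exact: slopesD.
Qed.

Lemma rational_functionN f : rational_function f -> rational_function (\- f).
Proof.
move=> fR; split; first by move=> p; apply: cvgN; exact: fR.1.
move=> p; have [n [r [phi [m [cp fm]]]]] := fR.2 p.
by exists n, r, phi, (fun i => - m i); split=> //; exact: slopesN.
Qed.

Lemma ordD f g p : rational_function f -> rational_function g ->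
  ord (f \+ g) p = ord f p + ord g p.
Proof.
move=> fR gR; have [n [r [phi [m [k [cp fm gk]]]]]] := common_slopes p fR gR.
rewrite (ordE cp fm) (ordE cp gk) (ordE cp (slopesD fm gk)).
by rewrite big_split.
Qed.

Lemma ordN f p : rational_function f -> ord (\- f) p = - ord f p.
Proof.
move=> fR; have [n [r [phi [m [cp fm]]]]] := fR.2 p.
by rewrite (ordE cp fm) (ordE cp (slopesN fm)) sumrN.
Qed.

(** Adding [div (truncate c f)] to D, rather than [div f], moves the chips of
    D only as far as the level c of f. *)
Definition truncate c f : Gamma -> R := fun x => Num.max (f x) c.

Definition truncated_slope f p c (m : int) : int :=
  if c < f p then m else if f p < c then 0 else Num.max m 0.

Lemma truncate_slopes f p c n r (phi : 'I_n -> R -> Gamma) m :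
  continuous f -> star_chart p r phi -> outgoing_slopes f p r phi m ->
  exists2 e, 0 < e <= r &
    outgoing_slopes (truncate c f) p e phi (truncated_slope f p c \o m).
Proof.
move=> /continuous_mdistP cf cp fm.
have [r0 _ _ _] := cp.
have near0 d : 0 < d -> exists2 e, 0 < e <= r &
    forall i t, 0 <= t < e -> `|f p - f (phi i t)| < d.
  move=> d0; have [e e0 eP] := cf p d d0.
  exists (Num.min e r); first by rewrite lt_min e0 r0 ge_min lexx orbT.
  move=> i t /andP[t0]; rewrite lt_min => /andP[te tr]; apply: eP.
  by rewrite (star_chart_dist _ cp)// t0.
case: (ltgtP c (f p)) => cfp.
- have [|e er eP] := near0 (f p - c); first by rewrite subr_gt0.
  exists e => // i t te; have /andP[e0 er'] := er.
  have := eP i t te; rewrite ltr_norml => /andP[? ?].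
  rewrite /truncate /truncated_slope /= cfp !max_l; [|lra|lra].
  by apply: fm; lra.
- have [|e er eP] := near0 (c - f p); first by rewrite subr_gt0.
  exists e => // i t te; rewrite /truncate /truncated_slope /= cfp ltNge (ltW cfp)/=.
  have := eP i t te; rewrite ltr_norml => /andP[? ?].
  rewrite !max_r ?mul0r ?addr0//; lra.
- exists r; first by rewrite r0 lexx.
  move=> i t tr; rewrite /truncate /truncated_slope /= -cfp ltxx maxxx fm// -cfp.
  case/andP: tr => t0 _.
  case: (leP 0 (m i)) => mi; rewrite ?mul0r ?addr0.
    by rewrite max_l// lerDl mulr_ge0// ler0z.
  by rewrite max_r// gerDl mulr_le0_ge0// lerz0 ltW.
Qed.

Lemma rational_truncate c f : rational_function f -> rational_function (truncate c f).
Proof.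
move=> fR; split.
  apply/continuous_mdistP => p e e0.
  have /continuous_mdistP/(_ p e e0)[d d0 dP] := fR.1; exists d => // q /dP.
  rewrite /truncate; apply: le_lt_trans; rewrite !maxEle.
  case: (lerP (f p) c) => h1; case: (lerP (f q) c) => h2.
  - by rewrite subrr normr0.
  - by rewrite distrC [leRHS]distrC !ger0_norm; lra.
  - by rewrite !ger0_norm; lra.
  - by [].
move=> p; have [n [r [phi [m [cp fm]]]]] := fR.2 p.
have [e er fe] := truncate_slopes c fR.1 cp fm.
by exists n, e, phi; eexists; split; [exact: star_chart_shrink cp er|exact: fe].
Qed.

Lemma ord_truncate c f p : rational_function f ->
  [/\ c < f p -> ord (truncate c f) p = ord f p,
      f p < c -> ord (truncate c f) p = 0 &
      f p = c -> 0 <= ord (truncate c f) p].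
Proof.
move=> fR; have [n [r [phi [m [cp fm]]]]] := fR.2 p.
have [e er fe] := truncate_slopes c fR.1 cp fm.
rewrite (ordE (star_chart_shrink cp er) fe) (ordE cp fm).
split=> h; rewrite /truncated_slope.
- by apply: eq_bigr => i _ /=; rewrite h.
- by apply: big1 => i _ /=; rewrite ltNge ltW//= h.
- by apply: sumr_ge0 => i _ /=; rewrite h ltxx le_max lexx orbT.
Qed.

(** On the level c, the order of the truncation is the sum of the positive
    slopes of f. If [a] plus this sum vanishes, then [a] is zero and no slope is
    positive; since [a + ord f p] is not negative, no slope is negative either. *)
Lemma level_locally_constant c f p (a : int) : rational_function f -> f p = c ->
  0 <= a -> 0 <= a + ord f p -> a + ord (truncate c f) p = 0 ->
  a = 0 /\ \forall q \near p, f q = c.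
Proof.
move=> fR fpc a0 af at0; have [n [r [phi [m [cp fm ordf]]]]] := ord_slopes p fR.
have [e er fe] := truncate_slopes c fR.1 cp.1 fm.
have mE := ordE (star_chart_shrink cp.1 er) fe.
have tm i : truncated_slope f p c (m i) = Num.max (m i) 0.
  by rewrite /truncated_slope fpc ltxx.
have mge0 : 0 <= ord (truncate c f) p by have [_ _ ->] := ord_truncate c p fR.
have a00 : a = 0 by lia.
have m0 i : m i = 0.
  have : \sum_i Num.max (m i) 0 = 0.
    by move: at0; rewrite a00 add0r mE => s0; rewrite -[RHS]s0; apply: eq_bigr => j _; rewrite /= tm.
  have maxge0 : forall j, true -> 0 <= Num.max (m j) 0 by move=> j _; rewrite le_max lexx orbT.
  move=> /eqP; rewrite psumr_eq0// => /allP mle.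
  have {}mle j : m j <= 0 by have := mle j (mem_index_enum _); rewrite eq_maxr.
  move: af; rewrite a00 add0r ordf => msum.
  have : \sum_j - m j = 0.
    by apply/eqP; rewrite eq_le sumrN oppr_le0 msum/= -sumrN sumr_ge0// => j _; rewrite oppr_ge0.
  move=> /eqP; rewrite psumr_eq0; last by move=> j _; rewrite oppr_ge0.
  by move=> /allP/(_ i (mem_index_enum _)); rewrite oppr_eq0 => /eqP.
split=> //; apply/nbhs_mdist; exists r; first by case: cp => -[].
move=> q qr; have [->//|/eqP qp] := eqVneq q p.
have [i [t [/andP[t0 tr] ->]]] := cp.2 q qr qp.
by rewrite fm ?(ltW t0)// m0 mul0r addr0.
Qed.

Lemma mk_ball_chart p n r (phi : 'I_n -> R -> Gamma) : 0 < r -> (forall i, phi i 0 = p) ->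
  (forall i j s t, 0 <= s < r -> 0 <= t < r ->
        mdist (phi i s) (phi j t) = star_dist (i, s) (j, t)) ->
  (forall q, mdist p q < r -> q <> p -> exists i t, 0 < t < r /\ q = phi i t) ->
  ball_chart p r phi.
Proof.
move=> r0 phi0 phid pin; split=> //; split=> //.
apply/nbhs_mdist; exists r => // q qr; have [->|/eqP qp] := eqVneq q p; first by left.
have [i [t [/andP[t0 tr] e]]] := pin q qr qp.
by right; exists i, t; split=> //; rewrite (ltW t0) tr.
Qed.

(** The two directions in which a point of a curve can be left; a chart at a
    point of valence two. *)
Definition two_rays (gamma : R -> Gamma) t0 (k : 'I_2) t : Gamma :=
  gamma (if k == ord0 then t0 + t else t0 - t).

Lemma ball_chart_open_ray p n r (phi : 'I_n -> R -> Gamma) i t0 e q :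
  ball_chart p r phi -> 0 < t0 -> e <= t0 -> t0 + e <= r -> mdist (phi i t0) q < e ->
  exists2 t, t0 - e < t < t0 + e & q = phi i t.
Proof.
move=> cp t00 et tr qe.
have e0 : 0 < e by exact: le_lt_trans (mdist_ge0 _ _) qe.
have t0r : 0 <= t0 < r by lra.
have pt0 : mdist p (phi i t0) = t0 by apply: star_chart_dist cp.1 _.
have [||j [t [/andP[t1 t2] qE]]] := cp.2 q.
- by have := metric_triangle p (phi i t0) q; rewrite pt0; lra.
- by move=> qp; move: qe; rewrite qp metric_sym pt0; lra.
have [_ _ phid _] := cp.1.
have := phid i j t0 t t0r; rewrite (ltW t1) t2 -qE => /(_ isT).
rewrite /star_dist/=; case: eqP => [ij|_] d; last by exfalso; move: qe; rewrite d; lra.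
exists t; last by rewrite qE ij.
by move: qe; rewrite d ltr_norml; lra.
Qed.

Lemma two_rays_chart (gamma : R -> Gamma) t0 e : 0 < e ->
  (forall s t, t0 - e < s < t0 + e -> t0 - e < t < t0 + e ->
    mdist (gamma s) (gamma t) = `|s - t|) ->
  (forall q, mdist (gamma t0) q < e ->
    exists2 t, t0 - e < t < t0 + e & q = gamma t) ->
  ball_chart (gamma t0) e (two_rays gamma t0).
Proof.
move=> e0 iso cover; apply: mk_ball_chart => //.
- by move=> k; rewrite /two_rays addr0 subr0; case: ifP.
- move=> k l s t /andP[s0 se] /andP[t1 te].
  rewrite /two_rays iso /star_dist/= ?eqxx; last 2 first.
  + by case: ifP => _; lra.
  + by case: ifP => _; lra.
  have -> : (k == l) = ((k == ord0) == (l == ord0)).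
    by apply/eqP/eqP => [->//|]; case: k l => [[|[|//]] ?] [[|[|//]] ?] //= _; exact/val_inj.
  case: (k == ord0); case: (l == ord0) => /=.
  + by congr (`|_|); lra.
  + by rewrite ger0_norm; lra.
  + by rewrite ler0_norm; lra.
  + by rewrite -normrN; congr (`|_|); lra.
- move=> q qe qp; have [t te qE] := cover q qe.
  case: (ltgtP t t0) => tt0.
  + by exists ord_max, (t0 - t); split; [lra|rewrite qE /two_rays/= subKr].
  + by exists ord0, (t - t0); split; [lra|rewrite qE /two_rays/= addrC subrK].
  + by case: qp; rewrite qE tt0.
Qed.

Lemma interior_chart p n r (phi : 'I_n -> R -> Gamma) i t0 e :
  ball_chart p r phi -> 0 < e -> e <= t0 -> t0 + e <= r ->
  ball_chart (phi i t0) e (two_rays (phi i) t0).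
Proof.
move=> cp e0 et tr; have [_ _ phid _] := cp.1; have t00 : 0 < t0 by lra.
apply: two_rays_chart => // [s t st tt|q]; last exact: (ball_chart_open_ray cp t00 et tr).
by rewrite phid /star_dist/= ?eqxx; [|lra|lra].
Qed.

Definition two_slopes (a b : int) (k : 'I_2) : int := if k == ord0 then a else b.

Lemma ord_two_slopes f (gamma : R -> Gamma) t0 e (a b : int) :
  ball_chart (gamma t0) e (two_rays gamma t0) ->
  (forall t, t0 <= t < t0 + e -> f (gamma t) = f (gamma t0) + a%:~R * (t - t0)) ->
  (forall t, t0 - e < t <= t0 -> f (gamma t) = f (gamma t0) + b%:~R * (t0 - t)) ->
  outgoing_slopes f (gamma t0) e (two_rays gamma t0) (two_slopes a b) /\
  ord f (gamma t0) = a + b.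
Proof.
move=> cp fa fb.
have fab : outgoing_slopes f (gamma t0) e (two_rays gamma t0) (two_slopes a b).
  move=> k t te; rewrite /two_rays /two_slopes; case: ifP => _.
    by rewrite fa; [congr (_ + _ * _)|]; lra.
  by rewrite fb; [congr (_ + _ * _)|]; lra.
by split=> //; rewrite (ordE cp.1 fab) big_ord_recl big_ord1.
Qed.

Lemma compact_balls (rho : Gamma -> R) : compact [set: Gamma] ->
  (forall p, 0 < rho p) ->
  exists F : {fset Gamma}, forall x, exists2 p, p \in F & mdist p x < rho p.
Proof.
move=> /compact_near_coveringP cG rho0.
(* The filter of all sufficiently large finite sets of centres. *)
pose FF : set_system {fset Gamma} :=
  [set A | exists F0, forall F : {fset Gamma}, (F0 `<=` F)%fset -> A F].
have FFF : Filter FF.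
  split; first by exists fset0.
  - move=> A B [F0 F0A] [F1 F1B]; exists (F0 `|` F1)%fset => F.
    by rewrite fsubUset => /andP[/F0A ? /F1B ?].
  - by move=> A B AB [F0 F0A]; exists F0 => F /F0A/AB.
have [|F0 F0P] := cG _ FF
  (fun (F : {fset Gamma}) x => exists2 p, p \in F & mdist p x < rho p) _.
- move=> x _; exists (ball x (rho x), [set F : {fset Gamma} | x \in F]) => /=; last first.
    by move=> [y F] [/=]; rewrite ballEmdist; exists x.
  split; first exact: nbhsx_ballx.
  by exists [fset x]%fset => F; rewrite fsub1set.
- by exists F0 => x; exact: F0P.
Qed.

(** In the interior of a ray the two outgoing slopes are opposite. *)
Lemma ord_isolated f p : rational_function f ->
  exists2 e, 0 < e & forall q, mdist p q < e -> q <> p -> ord f q = 0.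
Proof.
move=> fR; have [n [r [phi [m [cp fm _]]]]] := ord_slopes p fR.
have [r0 _ _ _] := cp.1.
exists r => // q qr qp.
have [i [t [/andP[t0 tr] ->]]] := cp.2 q qr qp.
have [e [e0 et er]] := pos_lt_both t0 (ltac:(lra) : 0 < r - t).
have ter : t + e <= r by lra.
have [||_ ->] := @ord_two_slopes f _ _ _ (m i) (- m i) (interior_chart i cp e0 (ltW et) ter).
- by move=> s st; rewrite !fm; [|lra|lra]; rewrite mulrBr; lra.
- by move=> s st; rewrite !fm; [|lra|lra]; rewrite intrN mulNr mulrBr; lra.
- by rewrite subrr.
Qed.

Lemma ord_finite_support f : compact [set: Gamma] -> rational_function f ->
  exists F : {fset Gamma}, forall p, p \notin F -> ord f p = 0.
Proof.
move=> cG fR.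
have /choice[rho rhoP] : forall p, exists e, 0 < e /\
    forall q, mdist p q < e -> q <> p -> ord f q = 0.
  by move=> p; have [e e0 eP] := ord_isolated p fR; exists e.
have [F FP] := compact_balls cG (fun p => (rhoP p).1).
exists F => x xF; have [p pF px] := FP x.
apply: (rhoP p).2 => // xp; by rewrite xp pF in xF.
Qed.

Lemma principal_divE f (F : {fset Gamma}) : (forall p, p \notin F -> ord f p = 0) ->
  principal_div f = \sum_(p <- F) << ord f p *g p >>.
Proof.
move=> FP; rewrite /principal_div (@fsbigTE _ _ _ _ F)// => p /FP ->.
exact: freegU0.
Qed.

Lemma coeff_principal_div f p : compact [set: Gamma] -> rational_function f ->
  coeff p (principal_div f) = ord f p.
Proof.
move=> cG fR; have [F FP] := ord_finite_support cG fR.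
rewrite (principal_divE FP) raddf_sum/=.
have [pF|pF] := boolP (p \in F).
  rewrite (big_fsetD1 p)//= coeffU eqxx mulr1 big_seq big1 ?addr0// => q.
  by rewrite !inE => /andP[/negbTE qp _]; rewrite coeffU qp mulr0.
rewrite FP// big_seq big1// => q qF; rewrite coeffU; case: eqP => [qp|_]; last by rewrite mulr0.
by rewrite qp (negbTE pF) in qF.
Qed.

Lemma deg_principal_div f (F : {fset Gamma}) : (forall p, p \notin F -> ord f p = 0) ->
  deg (principal_div f) = \sum_(p <- F) ord f p.
Proof.
move=> FP; rewrite (principal_divE FP) raddf_sum/=.
by apply: eq_bigr => p _; rewrite degU.
Qed.

End RationalFunctions.

(** * Subdivision into segments *)

Lemma connected_subset_clopen (T : topologicalType) (C U K : set T) :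
  connected C -> open U -> closed K -> C `&` U = C `&` K -> C `&` U !=set0 ->
  C `<=` U.
Proof.
move=> cC oU cK UK CU0; have <- : C `&` U = C; last by move=> x [].
by apply: cC => //; [exists U|exists K].
Qed.

Lemma closed_nbhsP (R : realType) (Gamma : metricType R) (K : set Gamma) p :
  closed K -> (forall e, 0 < e -> exists2 q, K q & mdist p q < e) -> K p.
Proof.
move=> cK pK; apply: contrapT => nKp.
have /nbhs_mdist[e e0 eP] : nbhs p (~` K).
  by apply: open_nbhs_nbhs; split; first exact: closed_openC.
by have [q Kq /eP] := pK e e0.
Qed.

Section Isometric.
Context {R : realType} {Gamma : metricType R}.
Implicit Types (gamma : R -> Gamma) (a b s t : R).

Definition isometric_on a b gamma :=
  forall s t, a <= s <= b -> a <= t <= b -> mdist (gamma s) (gamma t) = `|s - t|.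

(** Clamping the parameter turns an isometry of an interval into a continuous
    map of the whole line. *)
Lemma isometric_continuous_ext a b gamma : a <= b -> isometric_on a b gamma ->
  exists2 g : R -> Gamma, continuous g & forall t, a <= t <= b -> gamma t = g t.
Proof.
move=> ab iso; exists (fun t => gamma (Num.max a (Num.min b t))); last first.
  by move=> t /andP[at_ tb]; rewrite (min_r tb) (max_r at_).
move=> t; apply/metricType_numDomainType.cvgrPdist_lt => e e0.
apply/(@nbhs_ballP R R^o); exists e => // s; rewrite /ball/= => ts.
have cl x : a <= Num.max a (Num.min b x) <= b.
  by rewrite le_max lexx/= ge_max ab ge_min lexx.
rewrite iso//; apply: le_lt_trans ts.
rewrite !maxEle !minEle; case: (lerP b t) => h1; case: (lerP b s) => h2; rewrite ?ab;
  do 2?[case: (lerP a _) => ?]; do 2?[case: (ger0P (_ - _)) => ?]; lra.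
Qed.

Lemma isometric_connected a b gamma (J : set R) : isometric_on a b gamma ->
  is_interval J -> J `<=` `[a, b] -> connected (gamma @` J).
Proof.
move=> iso iJ Jab; have [ba|ab] := ltP b a.
  suff -> : J = set0 by rewrite image_set0; exact: connected0.
  by rewrite -subset0 => t /Jab /=; rewrite in_itv/=; lra.
have [g gc gE] := isometric_continuous_ext ab iso.
rewrite (@eq_imagel _ _ _ gamma g); last by move=> t /Jab; rewrite /= in_itv/=; exact: gE.
apply: connected_continuous_connected; last exact: continuous_subspaceT.
exact/connected_intervalP.
Qed.

Lemma isometric_closed a b gamma : a <= b -> isometric_on a b gamma ->
  closed (gamma @` `[a, b]).
Proof.
move=> ab iso; have [g gc gE] := isometric_continuous_ext ab iso.
rewrite (@eq_imagel _ _ _ gamma g); last by move=> t; rewrite /= in_itv/= => ?; apply: gE; lra.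
apply: compact_closed; first exact: metric_hausdorff.
by apply: continuous_compact; [exact: continuous_subspaceT|exact: segment_compact].
Qed.

End Isometric.

Lemma seq_max (R : realDomainType) (s : seq R) x : x \in s ->
  exists2 y, y \in s & forall z, z \in s -> z <= y.
Proof.
elim: s x => // x [|y s] IH z _.
  by exists x; rewrite ?inE// => w; rewrite inE => /eqP ->.
have [w ws wmax] := IH y (mem_head _ _).
case: (lerP x w) => xw.
  by exists w; rewrite ?(inE, ws, orbT)// => u; rewrite inE => /orP[/eqP ->//|/wmax].
exists x; rewrite ?mem_head// => u; rewrite inE => /orP[/eqP ->//|/wmax uw].
exact: le_trans uw (ltW xw).
Qed.

Section Segments.
Context {R : realType} {Gamma : metricType R}.
Implicit Types (gamma : R -> Gamma) (L s t : R) (P : {fset Gamma}).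

(** A closed edge of the subdivision by P, parametrised by length. Openness
    says that nothing branches off in its interior. *)
Definition segment P L gamma : Prop :=
  [/\ 0 < L, gamma 0 \in P /\ gamma L \in P, isometric_on 0 L gamma,
      (forall t, 0 < t < L -> gamma t \notin P) &
      open (gamma @` `]0, L[)].

Lemma segment_rev P L gamma : segment P L gamma ->
  segment P L (fun t => gamma (L - t)).
Proof.
move=> [L0 [g0 gL] iso gP gO]; split=> //.
- by rewrite subr0 subrr.
- by move=> s t sL tL; rewrite iso; [|lra|lra]; rewrite -normrN; congr (`|_|); lra.
- by move=> t tL; apply: gP; lra.
- rewrite (_ : _ @` _ = gamma @` `]0, L[)//.
  apply/seteqP; split=> x [t /=]; rewrite in_itv/= => tL <-; exists (L - t);
    rewrite /= ?in_itv/= ?subKr//; lra.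
Qed.

(** The open segment is also the trace of the closed one on the complement of
    P, since the end points are in P; so it is open and closed there. *)
Lemma segment_component P L gamma t : segment P L gamma -> 0 < t < L ->
  connected_component (~` [set` P]) (gamma t) = gamma @` `]0, L[.
Proof.
move=> [L0 [g0 gL] iso gP gO] tL; apply/seteqP; split; last first.
  apply: connected_component_max; first by exists t; rewrite //= in_itv.
    by move=> x [s /= + <-]; rewrite in_itv/= => /gP/negP.
  apply: isometric_connected iso (@interval_is_interval _ _) _.
  by move=> s /=; rewrite !in_itv/=; lra.
apply: (connected_subset_clopen (K := gamma @` `[0, L])) => //.
- exact: component_connected.
- exact: isometric_closed (ltW L0) iso.
- apply/seteqP; split=> [x [Cx [s /=]]|x [Cx [s /=]]]; rewrite in_itv/= => sL xE; split=> //.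
    by exists s; rewrite //= in_itv/=; lra.
  have nPx : ~ (x \in P) := connected_component_sub Cx.
  exists s; rewrite //= in_itv/=.
  case: (ltgtP s 0) => s0; [lra| |by rewrite -xE s0 g0 in nPx].
  case: (ltgtP s L) => sL'; [lra|lra|by rewrite -xE sL' gL in nPx].
- exists (gamma t); split; last by exists t; rewrite //= in_itv.
  by apply: connected_component_refl; apply/negP/gP.
Qed.

Lemma segment_chart P L gamma t : segment P L gamma -> 0 < t < L ->
  exists e, [/\ 0 < e, e <= t, t + e <= L & ball_chart (gamma t) e (two_rays gamma t)].
Proof.
move=> [L0 [g0 gL] iso gP gO] tL.
have /nbhs_mdist[d d0 dP] : nbhs (gamma t) (gamma @` `]0, L[).
  by apply: open_nbhs_nbhs; split=> //; exists t; rewrite //= in_itv.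
pose e := Num.min d (Num.min t (L - t)).
have [e0 ed et eL] : [/\ 0 < e, e <= d, e <= t & e <= L - t].
  by rewrite /e !lt_min !ge_min !lexx !orbT; split=> //; lra.
exists e; split=> //; first lra.
apply: two_rays_chart => // [s u se ue|q qe]; first by apply: iso; lra.
have [s /=] := dP q (lt_le_trans qe ed); rewrite in_itv/= => sL qE.
exists s => //; move: qe; rewrite -qE iso; [|lra|lra].
by rewrite ltr_norml; lra.
Qed.

End Segments.

Lemma fset_isolated (R : realType) (Gamma : metricType R) (P : {fset Gamma}) p :
  exists2 e : R, 0 < e & forall q, q \in P -> mdist p q < e -> q = p.
Proof.
suff [e e0 eP] : exists2 e : R, 0 < e &
    forall q, q \in (P : seq Gamma) -> mdist p q < e -> q = p.
  by exists e.
elim: (P : seq Gamma) => [|x s [e e0 eP]]; first by exists 1.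
have [->|xp] := eqVneq x p.
  by exists e => // q; rewrite inE => /orP[/eqP //|]; exact: eP.
exists (Num.min e (mdist p x)); first by rewrite lt_min e0 mdist_gt0 eq_sym.
move=> q; rewrite inE lt_min => /orP[/eqP ->|qs] /andP[qe qx]; last exact: eP.
by rewrite ltxx in qx.
Qed.

Section MetricGraph.
Context {R : realType} {Gamma : metricType R} (hG : metric_graph Gamma).
Implicit Types (gamma : R -> Gamma) (L s t e : R) (P : {fset Gamma}).

Lemma ball_chart_ex (p : Gamma) : exists c : {n : nat & 'I_n -> R -> Gamma},
  exists r : R, ball_chart p r (projT2 c).
Proof.
have [_ _ /(_ p)[n [r [phi /star_chart_ball[r' _ cp]]]]] := hG.
by exists (existT _ n phi), r'.
Qed.

(** A chart is chosen at each point once and for all. *)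
Definition nrays p : nat := projT1 (sval (cid (ball_chart_ex p))).
Definition ray p : 'I_(nrays p) -> R -> Gamma := projT2 (sval (cid (ball_chart_ex p))).
Definition chart_radius p : R := sval (cid (svalP (cid (ball_chart_ex p)))).

Lemma rayP p : ball_chart p (chart_radius p) (@ray p).
Proof. exact: (svalP (cid (svalP (cid (ball_chart_ex p))))). Qed.

Lemma chart_radius_gt0 p : 0 < chart_radius p.
Proof. by have [[]] := rayP p. Qed.

Lemma ray0 p i : @ray p i 0 = p.
Proof. by have [[]] := rayP p. Qed.

Lemma ray_dist p i t : 0 <= t < chart_radius p -> mdist p (@ray p i t) = t.
Proof. exact: star_chart_dist (rayP p).1. Qed.

Lemma ray_isometric p i s t : 0 <= s < chart_radius p -> 0 <= t < chart_radius p ->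
  mdist (@ray p i s) (@ray p i t) = `|s - t|.
Proof.
by have [_ _ phid _] := (rayP p).1 => sp tp; rewrite phid// /star_dist eqxx.
Qed.

Lemma valence_nrays p : valence p = nrays p.
Proof. exact: valenceE (rayP p).1. Qed.

Definition subdivided P := forall x, x \notin P -> exists L gamma t,
  [/\ segment P L gamma, 0 < t < L & x = gamma t].

(** Cover Gamma by the balls of half the chart radius around finitely many
    centres, and add to P0 the centres and the spheres that bound these balls.
    A further point lies in the interior of a ray of a chart, between two
    consecutive points of the ray that are in the new set. *)
Lemma subdivision P0 : exists2 P : {fset Gamma}, (P0 `<=` P)%fset & subdivided P.
Proof.
have [cG _ _] := hG.
have [F FP] := compact_balls cG (fun p => divr_gt0 (chart_radius_gt0 p) (ltr0Sn R 1)).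
pose sph := flatten [seq [seq @ray q i (chart_radius q / 2) | i <- enum 'I_(nrays q)] | q <- F].
pose P := (P0 `|` F `|` [fset x in sph])%fset.
have sphP q i : q \in F -> @ray q i (chart_radius q / 2) \in P.
  move=> qF; rewrite !inE; apply/orP; right; apply/flatten_mapP; exists q => //.
  by apply/mapP; exists i; rewrite ?mem_enum.
exists P; first by rewrite /P -fsetUA fsubsetUl.
move=> x xP; have [q qF qx] := FP x.
have qP : q \in P by rewrite !inE qF orbT.
have r0 := chart_radius_gt0 q.
have [||i [t0 [/andP[t00 t0r] xE]]] := (rayP q).2 x.
- by lra.
- by move=> xq; rewrite xq qP in xP.
have {qx}t0h : t0 < chart_radius q / 2 by move: qx; rewrite xE ray_dist//; lra.
(* A point of a ray at q has its distance to q as parameter, so the parameters of the finitely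
   many points of P on the ray occur in this list. *)
pose ds := [seq mdist q y | y <- P].
have inds t : 0 <= t < chart_radius q -> @ray q i t \in P -> t \in ds.
  by move=> tr tP; apply/mapP; exists (@ray q i t); rewrite ?ray_dist.
pose earlier := [seq d <- ds | (0 <= d < t0) && (@ray q i d \in P)].
have [|a] := @seq_max R earlier 0.
  by rewrite mem_filter lexx t00 ray0 qP/= inds ?lexx// ray0.
rewrite mem_filter => /andP[/andP[/andP[a0 at0] aP] _] amax.
pose later := [seq - d | d <- ds & (t0 < d <= chart_radius q / 2) && (@ray q i d \in P)].
have [|b'] := @seq_max R later (- (chart_radius q / 2)).
  apply/mapP; exists (chart_radius q / 2) => //.
  by rewrite mem_filter t0h lexx sphP//= inds ?sphP//; lra.
move=> /mapP[b]; rewrite mem_filter => /andP[/andP[/andP[t0b bh] bP] _] -> bmax.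
exists (b - a), (fun t => @ray q i (a + t)), (t0 - a); split; [|lra|by rewrite addrC subrK].
have iso : isometric_on 0 (b - a) (fun t => @ray q i (a + t)).
  by move=> s t sba tba; rewrite ray_isometric; [congr (`|_|)| |]; lra.
split=> //; first lra.
- by rewrite addr0 aP addrC subrK.
- move=> t tba; apply/negP => tP; have tds := inds (a + t) ltac:(lra) tP.
  case: (ltgtP (a + t) t0) => [h|h|h].
  + have := amax (a + t); rewrite mem_filter h tP tds !andbT => /(_ ltac:(lra)); lra.
  + have := bmax (- (a + t)); have -> : - (a + t) \in later.
      by apply/mapP; exists (a + t) => //; rewrite mem_filter h tP tds !andbT; lra.
    move=> /(_ isT); lra.
  + by move: xP; rewrite xE -h tP.
- rewrite openE => y [t /=]; rewrite in_itv/= => tba yE; apply/nbhs_mdist.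
  pose e := Num.min t (b - a - t).
  have [e0 et eL] : [/\ 0 < e, e <= t & e <= b - a - t].
    by rewrite /e lt_min !ge_min !lexx !orbT; split=> //; lra.
  exists e => // z; rewrite -yE => ze.
  have [||||s st zE] := @ball_chart_open_ray _ _ _ _ _ _ i (a + t) e z (rayP q); try lra.
  exists (s - a); first by rewrite /= in_itv/=; lra.
  by rewrite zE addrC subrK.
Qed.

End MetricGraph.

(** * Flags *)

Section Flags.
Context {R : realType} {Gamma : metricType R} (hG : metric_graph Gamma).
Implicit Types (gamma : R -> Gamma) (L s t e : R) (P : {fset Gamma}) (f : Gamma -> R).

Definition starts gamma p (i : 'I_(nrays hG p)) : Prop :=
  exists2 e, 0 < e <= chart_radius hG p & forall t, 0 <= t < e -> gamma t = ray i t.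

Lemma starts0 gamma p (i : 'I_(nrays hG p)) : starts gamma i -> gamma 0 = p.
Proof. by move=> [e /andP[e0 _] /(_ 0)]; rewrite ray0; apply; rewrite lexx. Qed.

Lemma starts_inj gamma p (i j : 'I_(nrays hG p)) : starts gamma i -> starts gamma j -> i = j.
Proof.
move=> [e /andP[e0 er] ei] [d /andP[d0 dr] dj].
pose m := Num.min e d; have [m0 me md] : [/\ 0 < m, m <= e & m <= d].
  by rewrite /m lt_min !ge_min !lexx !orbT e0.
have mr : 0 < m / 2 < chart_radius hG p by lra.
apply: (ball_chart_uniq (rayP hG p).1 mr mr _).1.
by rewrite -ei ?dj//; lra.
Qed.

Lemma segment_starts P L gamma p : segment P L gamma -> gamma 0 = p ->
  exists i : 'I_(nrays hG p), starts gamma i.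
Proof.
move=> [L0 _ iso _ _] g0.
pose m := Num.min L (chart_radius hG p); have [m0 mL mr] : [/\ 0 < m, m <= L & m <= chart_radius hG p].
  by rewrite /m lt_min !ge_min !lexx !orbT L0 chart_radius_gt0.
have [|i iP] := geodesic_ray (rayP hG p) m0 mr g0.
  by move=> s t sm tm; apply: iso; lra.
by exists i, m; rewrite ?m0.
Qed.

(** The beginning of the ray is connected and avoids P, so it lies inside one
    segment; [p] is in the closure of this segment and in P, so it is an end of
    it. *)
Lemma flag_segment P p (i : 'I_(nrays hG p)) : subdivided P -> p \in P ->
  exists L gamma, segment P L gamma /\ starts gamma i.
Proof.
move=> sP pP; have [d d0 dP] := fset_isolated P p.
have [e [e0 ed er]] := pos_lt_both d0 (chart_radius_gt0 hG p).
have rayP' t : 0 < t < e -> ray i t \notin P.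
  move=> te; apply/negP => /dP; rewrite ray_dist; last lra.
  move=> /(_ ltac:(lra)) rp; have := @ray_dist _ _ hG p i t ltac:(lra).
  by rewrite rp mdistxx; lra.
have [L [gamma [u [gseg uL gu]]]] := sP _ (rayP' (e / 2) ltac:(lra)).
have sub : ray i @` `]0, e[ `<=` gamma @` `]0, L[.
  rewrite -(segment_component gseg uL) -gu; apply: connected_component_max.
  - by exists (e / 2); rewrite //= in_itv/=; lra.
  - by move=> x [t /=]; rewrite in_itv/= => te <-; apply/negP/rayP'.
  - apply: (@isometric_connected _ _ 0 e) => //; last by move=> t /=; rewrite !in_itv/=; lra.
      by move=> s t se te; rewrite ray_isometric; [|lra|lra].
    exact: interval_is_interval.
have [L0 [g0 gL] iso gP gO] := gseg.
have [v /=] : (gamma @` `[0, L]) p.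
  apply: closed_nbhsP; first exact: isometric_closed (ltW L0) iso.
  move=> c c0; have [w [w0 wc we]] := pos_lt_both c0 e0.
  exists (ray i w); last by rewrite ray_dist; lra.
  have [|x /= xL <-] := sub (ray i w); first by exists w; rewrite //= in_itv/=; lra.
  by exists x => //=; move: xL; rewrite !in_itv/=; lra.
rewrite in_itv/= => vL gv.
have [L' [gamma' [gseg' g'0 sub']]] : exists L' gamma',
    [/\ segment P L' gamma', gamma' 0 = p & ray i @` `]0, e[ `<=` gamma' @` `]0, L'[].
  have [v0|v0] := eqVneq v 0; first by exists L, gamma; split=> //; rewrite v0 in gv.
  have vL' : v = L.
    by apply/eqP; apply/negPn/negP => vL'; have := gP v; rewrite gv pP => /(_ ltac:(lra)).
  exists L, (fun t => gamma (L - t)); split; first exact: segment_rev.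
    by rewrite subr0 -vL'.
  apply: (subset_trans sub) => x [t /=]; rewrite in_itv/= => tL <-.
  by exists (L - t); rewrite ?subKr//= in_itv/=; lra.
exists L', gamma'; split=> //; exists e; first by rewrite e0 ltW.
have [_ _ iso' _ _] := gseg'.
move=> t /andP[]; rewrite le_eqVlt => /predU1P[<- _|t0 te]; first by rewrite ray0.
have [|s /=] := sub' (ray i t); first by exists t; rewrite //= in_itv/= t0.
rewrite in_itv/= => sL' gs; rewrite -gs; congr gamma'.
have := @ray_dist _ _ hG p i t ltac:(lra); rewrite -gs -g'0 iso'; [|lra|lra].
by rewrite sub0r normrN gtr0_norm; [|lra].
Qed.

(** Both open segments are the component of the complement of P that contains
    the beginning of the ray, and on either one a point is determined by its
    distance to [p]. *)
Lemma starts_uniq P L L' gamma gamma' p (i : 'I_(nrays hG p)) :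
  segment P L gamma -> segment P L' gamma' -> starts gamma i -> starts gamma' i ->
  L = L' /\ forall t, 0 <= t <= L -> gamma t = gamma' t.
Proof.
move=> gs gs' st st'.
have [L0 [_ gLP] iso gP _] := gs; have [L'0 [_ gLP'] iso' gP' _] := gs'.
have g0 := starts0 st; have g'0 := starts0 st'.
have dg t : 0 <= t <= L -> mdist p (gamma t) = t.
  by move=> tL; rewrite -g0 iso; [rewrite sub0r normrN ger0_norm; lra|lra|lra].
have dg' t : 0 <= t <= L' -> mdist p (gamma' t) = t.
  by move=> tL; rewrite -g'0 iso'; [rewrite sub0r normrN ger0_norm; lra|lra|lra].
have II : gamma @` `]0, L[ = gamma' @` `]0, L'[.
  have [e /andP[e0 er] ei] := st; have [d /andP[d0 dr] dj] := st'.
  pose m := Num.min (Num.min e d) (Num.min L L').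
  have [m0 me md mL mL'] : [/\ 0 < m, m <= e, m <= d, m <= L & m <= L'].
    by rewrite /m !lt_min !ge_min !lexx !orbT e0 d0 L0 L'0.
  rewrite -(@segment_component _ _ P L gamma (m / 2))//; last lra.
  rewrite -(@segment_component _ _ P L' gamma' (m / 2))//; last lra.
  by rewrite ei ?dj//; lra.
have in1 t : 0 < t < L -> t < L' /\ gamma t = gamma' t.
  move=> tL; have [s /=] : (gamma' @` `]0, L'[) (gamma t).
    by rewrite -II; exists t; rewrite //= in_itv.
  rewrite in_itv/= => sL' gts.
  have ts : t = s by rewrite -(dg t) ?(ltW _)// -?gts ?dg'//; lra.
  by rewrite ts; split; [lra|rewrite gts -ts].
have in2 t : 0 < t < L' -> t < L.
  move=> tL; have [s /=] : (gamma @` `]0, L[) (gamma' t).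
    by rewrite II; exists t; rewrite //= in_itv.
  rewrite in_itv/= => sL gts.
  have -> : t = s by rewrite -(dg' t) ?(ltW _)// -?gts ?dg//; lra.
  lra.
have LL' : L = L'.
  apply/eqP; rewrite eq_le; apply/andP; split; rewrite leNgt; apply/negP => h.
    by have [] := in1 L' ltac:(lra); rewrite ltxx.
  by have := in2 L ltac:(lra); rewrite ltxx.
split=> // t tL.
have [->|t0] := eqVneq t 0; first by rewrite g0 g'0.
have [->|tL'] := eqVneq t L; last by apply: (in1 t _).2; lra.
have [s /=] : (gamma' @` `[0, L']) (gamma L).
  apply: closed_nbhsP; first exact: isometric_closed (ltW L'0) iso'.
  move=> e e0; have [w [w0 we wL]] := pos_lt_both e0 L0.
  exists (gamma' (L - w)); first by exists (L - w); rewrite //= in_itv/=; lra.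
  rewrite -(in1 (L - w) _).2; last lra.
  by rewrite iso; [rewrite opprB addrC subrK gtr0_norm|lra|lra].
rewrite in_itv/= => sL gsL.
have sL' : s = L by rewrite -(dg' s)// gsL dg//; lra.
by rewrite -gsL sL'.
Qed.

(** A flag is an end of a segment: a point of P with a ray at this point. *)
Definition flag P : finType := {p : P & 'I_(nrays hG (val p))}.

Definition opposite P (x y : flag P) : Prop :=
  exists L gamma, [/\ segment P L gamma, starts gamma (tagged x) &
    starts (fun t => gamma (L - t)) (tagged y)].

Lemma opposite_ex P (x : flag P) : subdivided P -> exists y, opposite x y.
Proof.
move=> sP; have [L [gamma [gs st]]] := flag_segment (tagged x) sP (valP (tag x)).
have [_ [_ gL] _ _ _] := gs.
have [|i st'] := @segment_starts P L (fun t => gamma (L - t)) (gamma L) (segment_rev gs).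
  by rewrite subr0.
by exists (existT (fun p : P => 'I_(nrays hG (val p))) [` gL]%fset i), L, gamma.
Qed.

Lemma opposite_sym P (x y : flag P) : opposite x y -> opposite y x.
Proof.
move=> [L [gamma [gs st st']]]; exists L, (fun t => gamma (L - t)).
split=> //; first exact: segment_rev.
by have [e er ei] := st; exists e => // t te; rewrite subKr ei.
Qed.

Lemma starts_flag_inj P gamma (x y : flag P) :
  starts gamma (tagged x) -> starts gamma (tagged y) -> x = y.
Proof.
case: x y => [p i] [q j] /= stp stq.
have pq : p = q by apply: val_inj; exact: etrans (esym (starts0 stp)) (starts0 stq).
by subst q; rewrite (starts_inj stp stq).
Qed.

Lemma opposite_uniq P (x y z : flag P) : opposite x y -> opposite x z -> y = z.
Proof.
move=> [L [gamma [gs st st']]] [L' [gamma' [gs' st2 st2']]].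
have [LL' gg'] := starts_uniq gs gs' st st2.
apply: (starts_flag_inj st'); have [L0 _ _ _ _] := gs.
have [e /andP[e0 er] ei] := st2'.
exists (Num.min e L); first by rewrite lt_min e0 L0 ge_min er.
move=> t /andP[t0]; rewrite lt_min => /andP[te tL].
by rewrite -ei ?t0// -LL' gg'//; lra.
Qed.

Section OppositeFun.
Variables (P : {fset Gamma}) (sP : subdivided P).

Definition opp_flag (x : flag P) : flag P := sval (cid (opposite_ex x sP)).

Lemma opp_flagP x : opposite x (opp_flag x).
Proof. exact: svalP (cid _). Qed.

Lemma opp_flagK : involutive opp_flag.
Proof. by move=> x; apply: opposite_uniq (opp_flagP _) (opposite_sym (opp_flagP x)). Qed.

End OppositeFun.

(** The outgoing slope of f along a ray, meaningful if f is affine at the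
    beginning of the ray; [slopeP] identifies it with the slopes that define the
    order. *)
Definition slope f p (i : 'I_(nrays hG p)) : int :=
  xget 0 [set m | exists2 e : R, 0 < e & forall t, 0 <= t < e -> f (ray i t) = f p + m%:~R * t].

Lemma slopeE f p (i : 'I_(nrays hG p)) (m : int) e : 0 < e ->
  (forall t, 0 < t < e -> f (ray i t) = f p + m%:~R * t) -> slope f i = m.
Proof.
move=> e0 fm; apply: xget_unique.
  exists e => // t /andP[]; rewrite le_eqVlt => /predU1P[<- _|t0 te].
    by rewrite ray0 mulr0 addr0.
  by rewrite fm ?t0.
move=> k [d d0 fk]; have [w [w0 we wd]] := pos_lt_both e0 d0.
have := fm w ltac:(lra); rewrite fk ?(ltW w0)// => /addrI.
by move=> /(mulIf (lt0r_neq0 w0))/eqP; rewrite eqr_int => /eqP.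
Qed.

Lemma slopeP f p : rational_function f ->
  (exists2 e, 0 < e <= chart_radius hG p & outgoing_slopes f p e (@ray _ _ hG p) (@slope f p)) /\
  ord f p = \sum_i slope f (i : 'I_(nrays hG p)).
Proof.
move=> fR; have [e [m [er fm]]] := rational_slopes fR (rayP hG p).1.
have sm i : @slope f p i = m i.
  by case/andP: er => e0 _; apply: (slopeE e0) => t /andP[t0 te]; rewrite fm ?te ?ltW.
split; first by exists e => // i t te; rewrite sm fm.
rewrite (ordE (star_chart_shrink (rayP hG p).1 er) fm).
by apply: eq_bigr => i _; rewrite sm.
Qed.

End Flags.

(** * The degree of a principal divisor *)

Lemma nbhs_normP (R : realType) (x : R) (A : set R) :
  nbhs x A <-> exists2 e, 0 < e & forall y, `|x - y| < e -> A y.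
Proof.
split=> [/(@nbhs_ballP R R^o)[e /= e0 eA]|[e e0 eA]]; first by exists e.
by apply/(@nbhs_ballP R R^o); exists e.
Qed.

(** The points near which g is the prescribed affine function form a set that
    is open, and closed because two affine functions which agree on a small
    interval are equal; so this set is all of the interval. *)
Lemma affine_propagates (R : realType) (g : R -> R) (L A m e0 : R) :
  0 < e0 ->
  (forall t, 0 < t < L -> exists (c : R) e, 0 < e /\
     forall s, `|t - s| < e -> g s = g t + c * (s - t)) ->
  (forall t, 0 < t < e0 -> g t = A + m * t) ->
  forall t, 0 < t < L -> g t = A + m * t.
Proof.
move=> e00 loc init t tL; have L0 : 0 < L by lra.
pose U : set R := [set t | \forall s \near t, g s = A + m * s].
suff : `]0, L[%classic `<=` U.
  by move=> /(_ t); rewrite /= in_itv/= => /(_ tL) /nbhs_singleton.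
apply: (@connected_subset_clopen R _ _ (closure U)).
- exact/connected_intervalP/interval_is_interval.
- by rewrite openE => x; exact: nbhs_interior.
- exact: closed_closure.
- apply/seteqP; split=> x [xL Ux]; split=> //; first exact: subset_closure.
  move: xL; rewrite /= in_itv/= => xL.
  have [c [e [ee eP]]] := loc x xL.
  have [u [Uu xu]] : exists u, U u /\ `|x - u| < e.
    have [|u [Uu xu]] := Ux (ball x e); first exact: (@nbhsx_ballx R R^o).
    by exists u.
  have /nbhs_normP[d d0 dP] := Uu.
  have [w [w0 wd we]] := pos_lt_both d0 (ltac:(lra) : 0 < e - `|x - u|).
  have u1 := dP u ltac:(by rewrite subrr normr0).
  have u2 := dP (u + w) ltac:(by rewrite opprD addNKr normrN gtr0_norm).
  have xuw : `|x - (u + w)| < e.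
    have := ler_normB (x - u) w; rewrite opprD addrA (gtr0_norm w0); lra.
  have := eP _ xuw; have := eP _ xu; rewrite u1 u2 => e1 e2.
  have /(mulIf (lt0r_neq0 w0)) cm : c * w = m * w.
    by move: e1 e2; rewrite !mulrBr !mulrDr; lra.
  have gx : g x = A + m * x by move: e1; rewrite cm mulrBr; lra.
  apply/nbhs_normP; exists e => // s /eP ->; rewrite gx cm mulrBr; lra.
- have [w [w0 wL we]] := pos_lt_both L0 e00.
  exists w; split; first by rewrite /= in_itv/= w0.
  apply/nbhs_normP; have [d [d0 dw dw']] := pos_lt_both w0 (ltac:(lra) : 0 < e0 - w).
  exists d => // s; rewrite ltr_norml => ?; apply: init; lra.
Qed.

Section Degree.
Context {R : realType} {Gamma : metricType R} (hG : metric_graph Gamma).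
Implicit Types (gamma : R -> Gamma) (L s t e : R) (P : {fset Gamma}) (f : Gamma -> R).

(** At an interior point the two outgoing slopes add up to the order, which
    is zero, so f has no kink. *)
Lemma affine_on_segment f P L gamma p (i : 'I_(nrays hG p)) : rational_function f ->
  (forall q, q \notin P -> ord f q = 0) -> segment P L gamma -> starts gamma i ->
  forall t, 0 < t < L -> f (gamma t) = f p + (slope f i)%:~R * t.
Proof.
move=> fR fP gs st; have [L0 _ _ gP _] := gs.
have [[e /andP[e0 er] fe] _] := slopeP hG p fR.
have [d /andP[d0 dr] gd] := st.
have m0 : 0 < Num.min e d by rewrite lt_min e0.
apply: (affine_propagates m0) => t tL.
  have [a [a0 at_ aL ca]] := segment_chart gs tL.
  have [b [m [/andP[b0 ba] fm]]] := rational_slopes fR ca.1.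
  have ord0m : m ord0 + m ord_max = 0.
    have := ordE (star_chart_shrink ca.1 (ltac:(by rewrite b0) : 0 < b <= a)) fm.
    rewrite fP ?gP// big_ord_recl big_ord1 => ->; congr (_ + m _); exact: val_inj.
  exists (m ord0)%:~R, b; split=> // s.
  have [ts|st'] := lerP t s => tsb.
    rewrite -(fm ord0 (s - t)); last lra.
    by rewrite /two_rays/= addrC subrK.
  have -> : m ord0 = - m ord_max by apply/eqP; rewrite -addr_eq0 ord0m.
  rewrite intrN mulNr -mulrN opprB -(fm ord_max (t - s)); last lra.
  by rewrite /two_rays/= subKr.
move: tL; rewrite lt_min => /andP[t0 /andP[te td]].
by rewrite gd ?(ltW t0)// fe// ltW.
Qed.

Lemma slope_opp f P (sP : subdivided P) (x : flag hG P) : rational_function f ->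
  (forall q, q \notin P -> ord f q = 0) ->
  slope f (tagged (opp_flag sP x)) = - slope f (tagged x).
Proof.
move=> fR fP; have [L [gamma [gs st st']]] := opp_flagP sP x.
have [L0 _ _ _ _] := gs.
have h := affine_on_segment fR fP gs st.
have h' := affine_on_segment fR fP (segment_rev gs) st'.
set m := slope f _ in h' *; set k := slope f _ in h *.
have e1 := h (L / 3) ltac:(lra); have e2 := h (L / 2) ltac:(lra).
have e3 := h' (L / 2) ltac:(lra); have e4 := h' (L - L / 3) ltac:(lra).
have L2 : L - L / 2 = L / 2 by lra.
rewrite subKr in e4; rewrite L2 in e3.
suff : (m + k)%:~R * (L / 6) = 0 :> R.
  move/eqP; rewrite mulf_eq0 intr_eq0 => /orP[/eqP|/eqP ?]; last by exfalso; lra.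
  lia.
by rewrite intrD mulrDl; lra.
Qed.

Lemma big_flag P (F : forall p : Gamma, 'I_(nrays hG p) -> int) :
  \sum_(p <- P) \sum_i F p i = \sum_(x : flag hG P) F _ (tagged x).
Proof.
rewrite big_seq_fsetE/= sig_big_dep/=.
by apply: eq_bigr => -[p i] _.
Qed.

(** The order at a point is the sum of the slopes over the flags at the point,
    and the slopes of opposite flags cancel. *)
Lemma sum_ord f P : subdivided P -> rational_function f ->
  (forall q, q \notin P -> ord f q = 0) -> \sum_(p <- P) ord f p = 0.
Proof.
move=> sP fR fP.
under eq_bigr => p _ do rewrite (slopeP hG p fR).2.
rewrite big_flag; set S := \sum_x _.
have : S = - S.
  rewrite {1}/S (reindex_inj (inv_inj (@opp_flagK _ _ _ _ sP)))/= -sumrN.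
  by apply: eq_bigr => x _; rewrite slope_opp.
lia.
Qed.

Lemma deg_principal_div0 f : rational_function f -> deg (principal_div f) = 0.
Proof.
move=> fR; have [cG _ _] := hG.
have [F FP] := ord_finite_support cG fR.
have [P FsP sP] := subdivision hG F.
have fP q : q \notin P -> ord f q = 0.
  by move=> qP; apply: FP; apply: contra qP; apply/fsubsetP.
by rewrite (deg_principal_div fP) (sum_ord sP).
Qed.

End Degree.

(** * Components of the complement of a finite set *)

Section Components.
Context {R : realType} {Gamma : metricType R} (hG : metric_graph Gamma).
Implicit Types (gamma : R -> Gamma) (L s t e : R) (P V : {fset Gamma}).

Local Notation component V := (connected_component (~` [set` V])).

Lemma ray_avoids V p : exists2 e, 0 < e < chart_radius hG p &
  forall (i : 'I_(nrays hG p)) t, 0 < t < e -> ray i t \notin V.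
Proof.
have [d d0 dV] := fset_isolated V p.
have [e [e0 ed er]] := pos_lt_both d0 (chart_radius_gt0 hG p).
exists e; first by rewrite e0.
move=> i t te; apply/negP => /dV; rewrite ray_dist; last lra.
move=> /(_ ltac:(lra)) rp; have := @ray_dist _ _ hG p i t ltac:(lra).
by rewrite rp mdistxx; lra.
Qed.

Lemma ray_connected p (i : 'I_(nrays hG p)) e (J : set R) : e < chart_radius hG p ->
  is_interval J -> J `<=` `[0, e] -> connected (@ray _ _ hG p i @` J).
Proof.
move=> er; apply: isometric_connected => s t se te.
by rewrite ray_isometric; [|lra|lra].
Qed.

Lemma ray_component V p (i : 'I_(nrays hG p)) e s t : e < chart_radius hG p ->
  (forall t, 0 < t < e -> ray i t \notin V) -> 0 < s < e -> 0 < t < e ->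
  component V (ray i s) (ray i t).
Proof.
move=> er iV se te.
have : (@ray _ _ hG p i @` `]0, e[) (ray i t) by exists t; rewrite //= in_itv.
apply: connected_component_max.
- by exists s; rewrite //= in_itv.
- by move=> x [u /=]; rewrite in_itv/= => ue <-; apply/negP/iV.
- apply: ray_connected er (@interval_is_interval _ _) _.
  by move=> u /=; rewrite !in_itv/=; lra.
Qed.

(** Small balls are connected, being unions of beginnings of rays. *)
Lemma near_component V p : p \notin V -> \forall q \near p, component V p q.
Proof.
move=> pV; have [e /andP[e0 er] eV] := ray_avoids V p.
apply/nbhs_mdist; exists e => // q qe.
have [->|/eqP qp] := eqVneq q p.
  by apply: connected_component_refl; exact/negP.
have [i [t [tr qE]]] := (rayP hG p).2 q (lt_trans qe er) qp.
have te : t < e by move: qe; rewrite qE ray_dist//; lra.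
have : (@ray _ _ hG p i @` `[0, t]) q by exists t => //=; rewrite in_itv/=; lra.
apply: connected_component_max.
- by exists 0; rewrite ?ray0//= in_itv/=; lra.
- move=> x [u /=]; rewrite in_itv/= => /andP[]; rewrite le_eqVlt => /predU1P[<- _ <-|u0 ut <-].
    by rewrite ray0; exact/negP.
  by apply/negP/eV; lra.
- apply: ray_connected er (@interval_is_interval _ _) _.
  by move=> u /=; rewrite !in_itv/=; lra.
Qed.

Lemma component_open V c : open (component V c).
Proof.
rewrite openE => x Cx; have xV : x \notin V by apply/negP; exact: connected_component_sub Cx.
apply: filterS (near_component xV) => y; exact: connected_component_trans.
Qed.

Lemma closure_component V c x : closure (component V c) x -> x \notin V -> component V c x.
Proof.
move=> Cx /near_component /Cx[y [Cy xy]].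
exact: connected_component_trans Cy (connected_component_sym xy).
Qed.

Lemma closure_component_ray V c p : closure (component V c) p -> p \in V ->
  exists i : 'I_(nrays hG p), exists2 e, 0 < e < chart_radius hG p &
    forall t, 0 < t < e -> component V c (ray i t).
Proof.
move=> Cp pV; have [e /andP[e0 er] eV] := ray_avoids V p.
have [|q [Cq /= pq]] := Cp (ball p e); first exact: nbhsx_ballx.
rewrite ballEmdist/= in pq.
have [qp|] := eqVneq q p.
  by have := connected_component_sub Cq; rewrite qp.
move=> /eqP qp; have [i [t [tr qE]]] := (rayP hG p).2 q (lt_trans pq er) qp.
have te : 0 < t < e by move: pq; rewrite qE ray_dist//; lra.
exists i, e; rewrite ?e0// => s se; apply: connected_component_trans Cq _.
by rewrite qE; apply: ray_component er (eV i) te se.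
Qed.

Lemma ray_closure_component V p (i : 'I_(nrays hG p)) e t : e < chart_radius hG p ->
  (forall t, 0 < t < e -> ray i t \notin V) -> 0 < t < e ->
  closure (component V (ray i t)) p.
Proof.
move=> er iV te U /nbhs_mdist[d d0 dU].
have [s [s0 sd se]] := pos_lt_both d0 (ltac:(lra) : 0 < e).
exists (ray i s); split; first by apply: ray_component er iV _ _; lra.
by apply: dU; rewrite ray_dist; lra.
Qed.

Lemma clopen_eq_setT (A : set Gamma) : open A -> closed A -> A !=set0 -> A = setT.
Proof.
have [_ cG _] := hG; move=> oA cA A0.
by apply: cG A0 _ _; exists A => //; rewrite setTI.
Qed.

(** Otherwise the component would be open and closed in Gamma. *)
Lemma closure_component_meets V c : V != fset0 -> c \notin V ->
  exists2 v, v \in V & closure (component V c) v.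
Proof.
move=> V0 cV; apply: contrapT => noV.
have clC : closed (component V c).
  apply/closure_id/seteqP; split; first exact: subset_closure.
  move=> x clx; apply: closure_component => //; apply/negP => xV; apply: noV.
  by exists x.
have CT : component V c = setT.
  apply: clopen_eq_setT => //; first exact: component_open.
  by exists c; apply: connected_component_refl; exact/negP.
have /fset0Pn[v vV] := V0; apply: noV; exists v => //.
by rewrite CT; apply: subset_closure.
Qed.

End Components.

(** * The ends of an edge *)

Section DihedralOrbit.
Variables (T : finType) (a b : T -> T).
Hypotheses (aK : involutive a) (bK : involutive b).
Let s x := b (a x).
Let s_inj : injective s.
Proof. by move=> x y /(inv_inj bK) /(inv_inj aK). Qed.

(** The map b conjugates s, the composite of the two involutions, to its
    inverse. As b fixes x, it maps s^k x to s^-k x. *)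
Lemma orbit_closed_b x y : b x = x -> fconnect s x y -> fconnect s x (b y).
Proof.
move=> bx /iter_findex <-; elim: (findex s x y) => [|n IH]; first by rewrite /= bx connect0.
rewrite (fconnect_sym s_inj) in IH; rewrite (fconnect_sym s_inj).
apply: connect_trans (connect1 _) IH.
by rewrite /= /s bK aK.
Qed.

Lemma orbit_closed_a x y : b x = x -> fconnect s x y -> fconnect s x (a y).
Proof.
move=> bx xy; rewrite -(bK (a y)); apply: orbit_closed_b => //.
exact: connect_trans xy (fconnect1 _ _).
Qed.

(** As b maps s^k x to s^-k x, it fixes this point only if s^2k x = x. For
    0 < k < N, where N is the length of the orbit, this means 2k = N. *)
Lemma orbit_fixed_order x y : b x = x -> fconnect s x y -> b y = y -> y != x ->
  (2 * findex s x y)%N = order s x.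
Proof.
move=> bx xy by_ yx; set k := findex s x y; have ky : iter k s x = y := iter_findex xy.
have kN : (k < order s x)%N := findex_max xy.
have k0 : (0 < k)%N by rewrite lt0n findex_eq0 eq_sym.
have rev n : iter n s (b (iter n s x)) = x.
  by elim: n => [|n IH]; [rewrite /= bx|rewrite iterSr /= /s bK aK].
have kk : iter (2 * k) s x = x
  by rewrite mul2n -addnn iterD ky (_ : y = b (iter k s x)) ?rev// ky.
have [k2|k2] := ltnP (2 * k) (order s x).
  have := findex_iter k2; rewrite kk findex0; lia.
have : iter (2 * k - order s x) s (iter (order s x) s x) = x by rewrite -iterD subnK.
rewrite (iter_order s_inj) => ki; have := @findex_iter _ s x (2 * k - order s x); rewrite ki findex0; lia.
Qed.

Lemma orbit_fixed_uniq x y z : b x = x -> fconnect s x y -> fconnect s x z ->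
  b y = y -> b z = z -> y != x -> z != x -> y = z.
Proof.
move=> bx xy xz by_ bz yx zx.
have := orbit_fixed_order bx xy by_ yx; have := orbit_fixed_order bx xz bz zx.
move=> e1 e2; rewrite -(iter_findex xy) -(iter_findex xz); congr iter; lia.
Qed.

End DihedralOrbit.

Lemma rev_ord2 n (i j : 'I_n) : n = 2%N -> i != j -> j = rev_ord i.
Proof.
move=> n2; rewrite -val_eqE /= => ij; apply: val_inj => /=.
have := ltn_ord i; have := ltn_ord j; lia.
Qed.

Section Ends.
Context {R : realType} {Gamma : metricType R} (hG : metric_graph Gamma).
Context (V : {fset Gamma}) (hV : vertex_set V).
Implicit Types (gamma : R -> Gamma) (L s t e : R).

Local Notation component V := (connected_component (~` [set` V])).

Lemma nrays_off_vertex_set p : p \notin V -> nrays hG p = 2%N.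
Proof.
move=> pV; rewrite -(valence_nrays hG).
have [_ h] := hV; have [//|] := eqVneq (valence p) 2%N.
by move=> /h; rewrite (negbTE pV).
Qed.

Section Subdivided.
Context (P : {fset Gamma}) (sP : subdivided P) (VP : (V `<=` P)%fset).
Implicit Types (x y : flag hG P).

(** At a point of valence two, pass to the other ray; at a point of V, stop.
    On two indices, [rev_ord] is the transposition. *)
Definition turn x : flag hG P :=
  existT _ (tag x) (if val (tag x) \in V then tagged x else rev_ord (tagged x)).

Lemma turnK : involutive turn.
Proof. by move=> [p i]; rewrite /turn/=; case: ifP => h; rewrite h ?rev_ordK. Qed.

Lemma turn_fixed x : val (tag x) \in V -> turn x = x.
Proof. by case: x => p i /= pV; rewrite /turn/= pV. Qed.

Lemma turn_other x y : val (tag x) = val (tag y) -> val (tag x) \notin V -> x != y ->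
  y = turn x.
Proof.
case: x y => [p i] [q j] /= /val_inj pq pV; subst q => xy.
rewrite /turn/= (negbTE pV); congr existT.
apply: rev_ord2; first exact: nrays_off_vertex_set.
by apply: contra_neq xy => ->.
Qed.

Let seg_ex x := cid (flag_segment (tagged x) sP (valP (tag x))).
Let segL x := sval (seg_ex x).
Let seg x := sval (cid (svalP (seg_ex x))).
Let segP x : segment P (segL x) (seg x) /\ starts (seg x) (tagged x).
Proof. exact: svalP (cid (svalP (seg_ex x))). Qed.
Let segK x := seg x @` `[0, segL x].

Lemma interior_point L gamma t : segment P L gamma -> 0 <= t <= L -> gamma t \notin P ->
  0 < t < L.
Proof.
move=> [L0 [g0 gL] _ _ _] tL gt; rewrite !lt_neqAle.
have -> : 0 != t by apply: contraNneq gt => <-.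
have -> : t != L by apply: contraNneq gt => ->.
by lra.
Qed.

Lemma end_point L gamma t : segment P L gamma -> 0 <= t <= L -> gamma t \in P ->
  t = 0 \/ t = L.
Proof.
move=> [_ _ _ gP _] tL; have [->|t0] := eqVneq t 0; first by left.
have [->|tL'] := eqVneq t L; first by right.
by rewrite (negbTE (gP t _)) //; lra.
Qed.

Lemma segments_agree L gamma L' gamma' : segment P L gamma -> segment P L' gamma' ->
  gamma @` `]0, L[ = gamma' @` `]0, L'[ -> gamma 0 = gamma' 0 ->
  forall t, 0 <= t < L' -> gamma t = gamma' t.
Proof.
move=> [L0 _ iso _ _] [L'0 _ iso' _ _] II g0 t /andP[].
rewrite le_eqVlt => /predU1P[<-//|t0 tL'].
have [s /=] : (gamma @` `]0, L[) (gamma' t) by rewrite II; exists t; rewrite //= in_itv/= t0.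
rewrite in_itv/= => sL gst; rewrite -gst; congr gamma.
have := iso 0 s ltac:(lra) ltac:(lra); rewrite gst g0 iso'; [|lra|lra].
by rewrite !sub0r !normrN !gtr0_norm//; lra.
Qed.

(** The two segments are the same component of the complement of P, so they
    have the same ends. *)
Lemma segment_unique x y L gamma L' gamma' s t : segment P L gamma -> segment P L' gamma' ->
  starts gamma (tagged x) -> starts gamma' (tagged y) ->
  0 < t < L -> 0 < s < L' -> gamma t = gamma' s -> y = x \/ y = opp_flag sP x.
Proof.
move=> gs gs' st st' tL sL' e.
have II : gamma @` `]0, L[ = gamma' @` `]0, L'[.
  by rewrite -(segment_component gs tL) -(segment_component gs' sL') e.
have [L0 [g0P gLP] iso gP _] := gs; have [L'0 [g'0P g'LP] _ _ _] := gs'.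
have [u /=] : (gamma @` `[0, L]) (gamma' 0).
  apply: closed_nbhsP; first exact: isometric_closed (ltW L0) iso.
  move=> d d0; have [w [w0 wd wL]] := pos_lt_both d0 L'0.
  exists (gamma' w); last first.
    have [_ _ iso' _ _] := gs'.
    by rewrite iso'; [rewrite sub0r normrN gtr0_norm|lra|lra].
  have [v /= vL <-] : (gamma @` `]0, L[) (gamma' w).
    by rewrite II; exists w; rewrite //= in_itv/= w0.
  by exists v => //; move: vL; rewrite /= !in_itv/=; lra.
rewrite in_itv/= => uL gu.
have key L1 gamma1 (x1 : flag hG P) : segment P L1 gamma1 -> starts gamma1 (tagged x1) ->
    gamma1 @` `]0, L1[ = gamma @` `]0, L[ -> gamma1 0 = gamma' 0 -> y = x1.
  move=> gs1 st1 II1 e0; apply/esym/(starts_flag_inj st1).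
  have agree := segments_agree gs1 gs' (etrans II1 II) e0.
  have [d /andP[d0 dr] dP] := st'.
  have [w [w0 wd wL]] := pos_lt_both d0 L'0.
  exists w; first by rewrite w0; lra.
  by move=> r rw; rewrite agree ?dP//; lra.
have [u0|uL'] := end_point gs uL ltac:(by rewrite gu).
  by left; apply: (key L gamma) => //; rewrite -gu u0.
right; have [L2 [gamma2 [gs2 st2 st2']]] := opp_flagP sP x.
have [LL2 gg2] := starts_uniq gs gs2 st st2; rewrite -LL2 in gs2 st2'.
apply: (key L (fun r => gamma2 (L - r))) => //; first exact: segment_rev.
  rewrite -(segment_component gs tL).
  rewrite -(@segment_component _ _ _ _ _ (L - t) (segment_rev gs2)); last lra.
  by rewrite subKr gg2//; lra.
by rewrite subr0 -gg2 -?gu ?uL'//; lra.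
Qed.

Lemma segK_cover c z : component V c z -> exists y, segK y z.
Proof.
move=> Cz; have zV : z \notin V by apply/negP; exact: connected_component_sub Cz.
have [zP|zP] := boolP (z \in P).
  have n2 := nrays_off_vertex_set zV.
  have i : 'I_(nrays hG z) by rewrite n2; exact: ord0.
  pose y : flag hG P := existT _ [` zP]%fset i.
  exists y; exists 0; last by rewrite (starts0 (segP y).2).
  by rewrite /= in_itv/= lexx/=; have [[/ltW ? _ _ _ _] _] := segP y.
have [L [gamma [t [gs tL ->]]]] := sP zP; have [L0 [g0 _] _ _ _] := gs.
have [i st] := segment_starts hG gs erefl.
pose y : flag hG P := existT _ [` g0]%fset i.
have [LL gg] := @starts_uniq _ _ hG _ _ _ _ _ _ i gs (segP y).1 st (segP y).2.
exists y; exists t; last by rewrite gg//; lra.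
by rewrite /= in_itv/= -LL; lra.
Qed.

(** The flags met on a walk that alternately follows a segment and crosses a
    point of valence two. *)
Definition flag_orbit x0 y := fconnect (turn \o opp_flag sP) x0 y.

(** If z is inside a segment, then both flags are its ends. Otherwise z is a
    point of valence two, and crossing it leads from one segment to the other. *)
Lemma segK_share x0 c z y w : turn x0 = x0 -> component V c z ->
  segK y z -> segK w z -> flag_orbit x0 y -> flag_orbit x0 w.
Proof.
move=> tx0 Cz [t /=]; rewrite in_itv/= => tL yz [s /=]; rewrite in_itv/= => sL wz Oy.
have zV : z \notin V by apply/negP; exact: connected_component_sub Cz.
have Oa v : flag_orbit x0 v -> flag_orbit x0 (opp_flag sP v).
  by apply: orbit_closed_a => //; [exact: opp_flagK|exact: turnK].
have [zP|zP] := boolP (z \in P); last first.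
  have tL' := interior_point (segP y).1 tL ltac:(by rewrite yz).
  have sL' := interior_point (segP w).1 sL ltac:(by rewrite wz).
  have [->//|->] := segment_unique (segP y).1 (segP w).1 (segP y).2 (segP w).2
    tL' sL' (etrans yz (esym wz)).
  exact: Oa.
have base v r : 0 <= r <= segL v -> seg v r = z ->
    exists2 v', val (tag v') = z & v = v' \/ v = opp_flag sP v'.
  move=> rL vz; have [r0|rL'] := end_point (segP v).1 rL ltac:(by rewrite vz).
    by exists v; [rewrite -vz r0 (starts0 (segP v).2)|left].
  exists (opp_flag sP v); last by right; rewrite opp_flagK.
  have [L2 [gamma2 [gs2 st2 st2']]] := opp_flagP sP v.
  have [LL2 gg2] := starts_uniq (segP v).1 gs2 (segP v).2 st2.
  have [L0 _ _ _ _] := gs2.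
  by rewrite -vz -(starts0 st2') subr0 gg2 ?rL' ?LL2//; lra.
have [y' y'z yy'] := base y t tL yz; have [w' w'z ww'] := base w s sL wz.
have Oy' : flag_orbit x0 y' by case: yy' Oy => -> // /Oa; rewrite opp_flagK.
suff Ow' : flag_orbit x0 w' by case: ww' => -> //; exact: Oa.
have [<-//|y'w'] := eqVneq y' w'.
rewrite (turn_other (etrans y'z (esym w'z)) _ y'w') ?y'z//.
by apply: orbit_closed_b => //; [exact: opp_flagK|exact: turnK].
Qed.

(** The segments on the walk and those off the walk cover the component by two
    closed sets, which are disjoint by [segK_share]; the component is
    connected. *)
Lemma orbit_fills_component x0 c : turn x0 = x0 ->
  (exists2 z, segK x0 z & component V c z) ->
  forall z, component V c z -> exists2 y, flag_orbit x0 y & segK y z.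
Proof.
move=> tx0 [z0 x0z0 Cz0].
pose A := \bigcup_(y in [set y | flag_orbit x0 y]) segK y.
pose B := \bigcup_(y in [set y | ~~ flag_orbit x0 y]) segK y.
have clK y : closed (segK y).
  by have [[L0 _ iso _ _] _] := segP y; exact: isometric_closed (ltW L0) iso.
have cA : closed A by apply: closed_bigcup => //; exact: finite_finset.
have cB : closed B by apply: closed_bigcup => //; exact: finite_finset.
have CAB z : component V c z -> A z <-> ~ B z.
  move=> Cz; split.
    by move=> [y Oy yz] [w /negP Ow wz]; apply: Ow; exact: segK_share Cz yz wz Oy.
  have [y yz] := segK_cover Cz; move=> nB; exists y => //=.
  by apply: contrapT => nO; apply: nB; exists y => //=; exact/negP.
have : component V c `<=` ~` B.
  apply: (connected_subset_clopen (K := A)) => //.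
  - exact: component_connected.
  - exact: closed_openC.
  - by apply/seteqP; split=> z [Cz h]; split=> //; exact/(CAB z Cz).
  - exists z0; split=> //; apply/(CAB z0 Cz0); exists x0 => //=; exact: connect0.
by move=> CB z Cz; have /(CAB z Cz)[y ? ?] := CB z Cz; exists y.
Qed.

Lemma end_flag c v : v \in V -> closure (component V c) v -> exists x,
  [/\ val (tag x) = v, turn x = x & exists2 t, 0 < t < segL x & component V c (seg x t)].
Proof.
move=> vV Cv; have [i [e /andP[e0 er] eC]] := closure_component_ray hG Cv vV.
pose x : flag hG P := existT _ [` fsubsetP VP v vV]%fset i.
have [gs st] := segP x; have [L0 _ _ _ _] := gs; have [d /andP[d0 dr] dP] := st.
exists x; split=> //; first exact: turn_fixed.
have [w [w0 we wd]] := pos_lt_both e0 d0; have [t [t0 tw tL]] := pos_lt_both w0 L0.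
exists t; first by rewrite t0.
by rewrite dP; [apply: eC|]; lra.
Qed.

Lemma subdivided_ends_uniq c u v w : u \in V -> v \in V -> w \in V ->
  closure (component V c) u -> closure (component V c) v -> closure (component V c) w ->
  v != u -> w != u -> v = w.
Proof.
move=> uV vV wV Cu Cv Cw vu wu.
have [x0 [x0u tx0 [t0 t0L Ct0]]] := end_flag uV Cu.
have inO v' : v' \in V -> closure (component V c) v' ->
    exists y, [/\ val (tag y) = v', turn y = y & flag_orbit x0 y].
  move=> v'V Cv'; have [y [yv' ty [t tL Ct]]] := end_flag v'V Cv'; exists y; split=> //.
  have [||z Oz zt] := @orbit_fills_component x0 c tx0 _ (seg y t) => //.
    by exists (seg x0 t0) => //; exists t0 => //=; rewrite in_itv/=; lra.
  have yt : segK y (seg y t) by exists t; rewrite //= in_itv/=; lra.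
  exact: segK_share tx0 Ct zt yt Oz.
have [y [yv ty Oy]] := inO v vV Cv; have [z [zw tz Oz]] := inO w wV Cw.
suff yz : y = z by rewrite -yv -zw yz.
apply: (orbit_fixed_uniq (@opp_flagK _ _ _ _ sP) turnK tx0 Oy Oz ty tz).
- by apply: contra_neq vu => yx; rewrite -yv yx.
- by apply: contra_neq wu => zx; rewrite -zw zx.
Qed.

End Subdivided.

(** A component of the complement of V has at most two boundary points: these
    are fixed by [turn], and they all lie on one walk. *)
Lemma closure_ends_uniq c u v w : u \in V -> v \in V -> w \in V ->
  closure (component V c) u -> closure (component V c) v -> closure (component V c) w ->
  v != u -> w != u -> v = w.
Proof. by have [P VP sP] := subdivision hG V; exact: (subdivided_ends_uniq sP VP). Qed.

End Ends.

(** * The graph of a simple model *)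

Section Adjacency.
Context {R : realType} {Gamma : metricType R} (hG : metric_graph Gamma).
Context (V : {fset Gamma}) (hV : vertex_set V) (hs : simple_model V).
Implicit Types (u v w c : Gamma).

Local Notation component V := (connected_component (~` [set` V])).

Lemma component_edge c : c \notin V -> edges V (closure (component V c)).
Proof. by move=> cV; exists c => //=; exact/negP. Qed.

Lemma component_two_ends c : c \notin V -> exists u v,
  [/\ u \in V, v \in V, u != v, closure (component V c) u & closure (component V c) v].
Proof.
move=> cV; have [V0 _] := hV.
have [u uV Cu] := closure_component_meets hG V0 cV.
have [nl _] := hs; apply: contrapT => no; apply: (nl _ (component_edge cV)).
exists u; apply/seteqP; split=> [v [Cv /= vV]|v -> //].
by apply: contrapT => /eqP vu; apply: no; exists v, u.
Qed.

Lemma component_edge_ends c u v : u \in V -> v \in V -> u != v ->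
  closure (component V c) u -> closure (component V c) v ->
  edge_ends V (closure (component V c)) = [set u; v].
Proof.
move=> uV vV uv Cu Cv; apply/seteqP; split=> [w [Cw /= wV]|w [->|->] //].
have [->|wu] := eqVneq w u; [by left|right].
by apply: (closure_ends_uniq hG hV uV wV vV Cu Cw Cv wu); rewrite eq_sym.
Qed.

Lemma adjacentP u v : Defs.adjacent V u v <->
  u != v /\ exists c, [/\ c \notin V, u \in V, v \in V,
     closure (component V c) u & closure (component V c) v].
Proof.
split=> [[/eqP uv [e [c /= /negP cV <-] ends]]|[uv [c [cV uV vV Cu Cv]]]].
  have [Cu uV] : edge_ends V (closure (component V c)) u by rewrite ends; left.
  have [Cv vV] : edge_ends V (closure (component V c)) v by rewrite ends; right.
  by split=> //; exists c.
split; first exact/eqP.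
exists (closure (component V c)); first exact: component_edge.
exact: component_edge_ends.
Qed.

Lemma adjacent_sym u v : Defs.adjacent V u v -> Defs.adjacent V v u.
Proof.
by move=> /adjacentP[uv [c [? ? ? ? ?]]]; apply/adjacentP; rewrite eq_sym; split=> //; exists c.
Qed.

(** The vertices in S and the open edges which end in S together form an open
    and closed subset of Gamma. *)
Lemma adjacent_connected (S : set Gamma) v0 : v0 \in V -> S v0 ->
  (forall u v, Defs.adjacent V u v -> S u -> S v) -> forall v, v \in V -> S v.
Proof.
move=> v0V Sv0 Sadj.
pose A : set Gamma := [set x | if x \in V then S x else
  exists u, [/\ u \in V, S u & closure (component V x) u]].
have locally x : \forall y \near x, A x <-> A y.
  have [xV|xV] := boolP (x \in V); last first.
    apply: filterS (near_component hG xV) => y xy.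
    have yV : y \notin V by apply/negP; exact: connected_component_sub xy.
    by rewrite /A/= (negbTE xV) (negbTE yV) (same_connected_component xy).
  have [e /andP[e0 er] eV] := ray_avoids hG V x.
  apply/nbhs_mdist; exists e => // y xy.
  have [->//|/eqP yx] := eqVneq y x.
  have [i [t [tr yE]]] := (rayP hG x).2 y (lt_trans xy er) yx.
  have te : 0 < t < e by move: xy; rewrite yE ray_dist//; lra.
  have Cx : closure (component V y) x by rewrite yE; exact: ray_closure_component er (eV i) te.
  have yV : y \notin V by rewrite yE eV.
  rewrite /A/= xV (negbTE yV); split=> [Sx|[u [uV Su Cu]]]; first by exists x.
  have [<-//|ux] := eqVneq u x.
  by apply: (Sadj u) Su; apply/adjacentP; split=> //; exists y.
have AT : A = setT.
  apply: (clopen_eq_setT hG).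
  - rewrite openE => x Ax; apply: filterS (locally x) => y [+ _]; exact.
  - rewrite -openC openE => x nAx; apply: filterS (locally x) => y [_ +] /=; move=> h /h; exact.
  - by exists v0; rewrite /A/= v0V.
by move=> v vV; have : A v by [rewrite AT]; rewrite /A/= vV.
Qed.

Lemma card_vertices_gt1 : (exists p q : Gamma, p <> q) ->
  exists u v, [/\ u \in V, v \in V & u != v].
Proof.
move=> [p [q /eqP pq]]; have ends c : c \notin V -> exists u v, [/\ u \in V, v \in V & u != v].
  by move=> /component_two_ends[u [v [uV vV uv _ _]]]; exists u, v.
have [pV|/ends//] := boolP (p \in V); have [qV|/ends//] := boolP (q \in V).
by exists p, q.
Qed.

(** A neighbour of v is determined by the edge that leads to it, and this edge
    by any ray at v along which it starts. *)
Lemma degree_le_valence (v : V) :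
  (#|[pred u : V | `[< Defs.adjacent V (val v) (val u) >]]| <= nrays hG (val v))%N.
Proof.
pose enters (u : V) (i : 'I_(nrays hG (val v))) := exists c e,
  [/\ closure (component V c) (val u), 0 < e &
      forall t, 0 < t < e -> component V c (ray i t)].
have /choice[h hP] : forall u : V, exists i : option 'I_(nrays hG (val v)),
    Defs.adjacent V (val v) (val u) -> exists2 j, i = Some j & enters u j.
  move=> u; have [/adjacentP[vu [c [cV vV uV Cv Cu]]]|na] :=
    pselect (Defs.adjacent V (val v) (val u)).
    have [i [e /andP[e0 _] eC]] := closure_component_ray hG Cv vV.
    by exists (Some i) => _; exists i => //; exists c, e.
  by exists None.
rewrite -[leqRHS]card_ord -cardsT -(card_imset _ (@Some_inj _)).
rewrite -(@card_in_imset _ _ h); last first.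
  move=> u u' /(@asboolW (Defs.adjacent _ _ _)) vu /(@asboolW (Defs.adjacent _ _ _)) vu' hu.
  have [i hi [c [e [Cu e0 eC]]]] := hP u vu.
  have [i' hi' [c' [e' [Cu' e'0 e'C]]]] := hP u' vu'.
  have ii' : i = i' by apply: Some_inj; rewrite -hi -hi'.
  subst i'; have [w [w0 we we']] := pos_lt_both e0 e'0.
  have cc' : component V c = component V c'.
    have h1 : component V c (ray i w) by apply: eC; lra.
    have h2 : component V c' (ray i w) by apply: e'C; lra.
    by rewrite (same_connected_component h1) (same_connected_component h2).
  have Cv : closure (component V c) (val v).
    move=> U /nbhs_mdist[d d0 dU].
    have [s [s0 sd sr]] := pos_lt_both d0 (chart_radius_gt0 hG (val v)).
    have [r [r0 rs re]] := pos_lt_both s0 e0.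
    exists (ray i r); split; first by apply: eC; lra.
    by apply: dU; rewrite ray_dist; lra.
  have /adjacentP[vu1 _] := vu; have /adjacentP[vu2 _] := vu'.
  apply: val_inj; rewrite -cc' in Cu'.
  by apply: (closure_ends_uniq hG hV (valP v) (valP u) (valP u') Cv Cu Cu'); rewrite eq_sym.
apply: subset_leq_card; apply/fintype.subsetP => o
  /imsetP[u /(@asboolW (Defs.adjacent _ _ _)) vu ->].
by have [j -> _] := hP u vu; apply/imsetP; exists j.
Qed.

End Adjacency.

Section MaxValence.
Context {R : realType} {Gamma : metricType R} (hG : metric_graph Gamma).
Context (V : {fset Gamma}) (hV : vertex_set V).

(** Off V all valences are 2, so the valences are bounded and [max_valence] is
    an actual maximum. *)
Lemma valence_le_max (p : Gamma) : (valence p <= max_valence Gamma)%N.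
Proof.
pose N := maxn 2 (\max_(v : V) valence (val v)).
have bound (q : Gamma) : (valence q <= N)%N.
  have [_ hV2] := hV; have [->|q2] := eqVneq (valence q) 2%N; first exact: leq_maxl.
  have qV : q \in V := hV2 q q2.
  apply: leq_trans (leq_maxr _ _).
  exact: (@leq_bigmax _ (fun v : V => valence (val v)) [` qV]%fset).
have ex : exists n, `[< exists q : Gamma, valence q = n >].
  by exists (valence p); apply/asboolP; exists p.
have ub n : `[< exists q : Gamma, valence q = n >] -> (n <= N)%N by move=> /asboolP[q <-].
have [m /asboolP[q qm] mmax] := ex_maxnP ex ub.
suff -> : max_valence Gamma = m by apply: mmax; apply/asboolP; exists p.
rewrite /max_valence /maximum; apply: xget_unique.
  split; first by exists q.
  by move=> n [r _ <-]; rewrite leEnat; apply: mmax; apply/asboolP; exists r.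
move=> n [[r _ rn] /(_ m)]; rewrite leEnat => mn; apply/eqP; rewrite eqn_leq.
rewrite mn; last by exists q.
by rewrite andbT; apply: mmax; apply/asboolP; exists r.
Qed.

End MaxValence.

(** * The spectral gap of a weighted graph *)

Section WeightedLaplacian.
Context {R : realType} {T : finType} (w : T -> T -> R).
Hypotheses (w_sym : forall u v, w u v = w v u) (w_ge0 : forall u v, 0 <= w u v).
Implicit Types f g h : T -> R.

(** The Laplacian of a graph whose edge uv has weight w u v; in the application
    the weights are 0 and 1. *)
Definition wlap f v : R := \sum_u w v u * (f v - f u).
Definition bform f g : R := \sum_v g v * wlap f v.
Definition dotp f g : R := \sum_v f v * g v.

Lemma wlapDZ f g a v : wlap (fun x => f x + a * g x) v = wlap f v + a * wlap g v.
Proof.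
rewrite /wlap mulr_sumr -big_split/=; apply: eq_bigr => u _; ring.
Qed.

Lemma sum_wlap f : \sum_v wlap f v = 0.
Proof.
set S := \sum_v _; suff : S = - S by move=> h; lra.
rewrite {1}/S /wlap exchange_big/= -sumrN; apply: eq_bigr => u _.
by rewrite -sumrN; apply: eq_bigr => v _; rewrite w_sym; ring.
Qed.

Lemma bform_sym_sum f g :
  bform f g *+ 2 = \sum_v \sum_u w v u * ((f v - f u) * (g v - g u)).
Proof.
have -> : bform f g = \sum_v \sum_u w v u * (f v - f u) * g v.
  by apply: eq_bigr => v _; rewrite /wlap mulr_sumr; apply: eq_bigr => u _; rewrite mulrC.
rewrite mulr2n {2}exchange_big/= -big_split/=; apply: eq_bigr => v _.
by rewrite -big_split/=; apply: eq_bigr => u _; rewrite (w_sym u v); ring.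
Qed.

Lemma bformC f g : bform f g = bform g f.
Proof.
suff : bform f g *+ 2 = bform g f *+ 2 by rewrite !mulr2n; lra.
rewrite !bform_sym_sum.
by apply: eq_bigr => v _; apply: eq_bigr => u _; rewrite (mulrC (f v - f u)).
Qed.

Lemma energyE f : bform f f *+ 2 = \sum_v \sum_u w v u * (f v - f u) ^+ 2.
Proof. exact: bform_sym_sum. Qed.

Lemma energy_ge0 f : 0 <= bform f f.
Proof.
rewrite -(@pmulrn_lge0 _ _ 2)// energyE; apply: sumr_ge0 => v _; apply: sumr_ge0 => u _.
by rewrite mulr_ge0// sqr_ge0.
Qed.

Lemma energy0 f u v : bform f f = 0 -> 0 < w u v -> f u = f v.
Proof.
move=> f0 uv; have /eqP := energyE f; rewrite f0 mul0rn eq_sym psumr_eq0; last first.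
  by move=> x _; apply: sumr_ge0 => y _; rewrite mulr_ge0// sqr_ge0.
move=> /allP/(_ u (mem_index_enum _))/=; rewrite psumr_eq0; last first.
  by move=> y _; rewrite mulr_ge0// sqr_ge0.
move=> /allP/(_ v (mem_index_enum _))/=; rewrite mulf_eq0 (gt_eqF uv) sqrf_eq0 subr_eq0.
by move=> /eqP.
Qed.

Lemma bformDZ f h t :
  bform (fun x => f x + t * h x) (fun x => f x + t * h x) =
  bform f f + 2 * t * bform f h + t ^+ 2 * bform h h.
Proof.
have -> : 2 * t * bform f h = t * bform f h + t * bform h f by rewrite (bformC h f); ring.
rewrite /bform !mulr_sumr -!big_split/=; apply: eq_bigr => v _.
rewrite wlapDZ; ring.
Qed.

Lemma dotpDZ f h t :
  dotp (fun x => f x + t * h x) (fun x => f x + t * h x) =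
  dotp f f + 2 * t * dotp f h + t ^+ 2 * dotp h h.
Proof.
rewrite /dotp !mulr_sumr -!big_split/=; apply: eq_bigr => v _; ring.
Qed.

Lemma dotp_ge0 f : 0 <= dotp f f.
Proof. by apply: sumr_ge0 => v _; rewrite -expr2 sqr_ge0. Qed.

Lemma dotp_eq0 f : dotp f f = 0 -> forall v, f v = 0.
Proof.
move=> /eqP; rewrite psumr_eq0; last by move=> v _; rewrite -expr2 sqr_ge0.
by move=> /allP f0 v; have := f0 v (mem_index_enum _); rewrite -expr2 sqrf_eq0 => /eqP.
Qed.

Let entry (x : 'rV[R]_#|T|) (v : T) : R := x ord0 (enum_rank v).

Lemma continuous_sum_fun (X : topologicalType) (I : Type) (r : seq I) (F : I -> X -> R) :
  (forall i, continuous (F i)) -> continuous (fun x => \sum_(i <- r) F i x).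
Proof.
move=> Fc; elim: r => [|i r IH].
  rewrite (_ : (fun _ => _) = cst 0); first by move=> x; exact: cvg_cst.
  by apply/funext => x; rewrite big_nil.
rewrite (_ : (fun _ => _) = F i \+ (fun x => \sum_(i <- r) F i x)).
  by move=> x; apply: cvgD; [exact: Fc|exact: IH].
by apply/funext => x; rewrite big_cons.
Qed.

Lemma entry_continuous v : continuous (entry^~ v).
Proof. exact: coord_continuous. Qed.

Lemma sumr_indicator (v : T) : \sum_u (u == v)%:R = 1 :> R.
Proof. by rewrite (bigD1 v)//= eqxx big1 ?addr0// => u /negbTE ->. Qed.

(** The vectors of mean zero and norm one form a compact set, on which the
    energy attains its minimum. *)
Lemma rayleigh_minimizer : (exists u v : T, u != v) ->
  exists f, [/\ \sum_v f v = 0, dotp f f = 1 &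
    forall g, \sum_v g v = 0 -> bform f f * dotp g g <= bform g g].
Proof.
move=> [u0 [v0 uv]].
pose K : set 'rV[R]_#|T| := [set x | \sum_v entry x v = 0] `&` [set x | dotp (entry x) (entry x) = 1].
have sumc : continuous (fun x => \sum_v entry x v).
  by apply: continuous_sum_fun; exact: entry_continuous.
have dotc : continuous (fun x => dotp (entry x) (entry x)).
  apply: (@continuous_sum_fun _ _ _ (fun v x => entry x v * entry x v)) => v x.
  exact: (continuousM (@entry_continuous v x) (@entry_continuous v x)).
have bc : continuous (fun x => bform (entry x) (entry x)).
  apply: (@continuous_sum_fun _ _ _ (fun v x => entry x v * wlap (entry x) v)) => v x.
  apply: (continuousM (@entry_continuous v x)).
  apply: (@continuous_sum_fun _ _ _ (fun u x => w v u * (entry x v - entry x u))) => u {}x.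
  exact: (continuousM (@cst_continuous _ _ (w v u) x)
           (continuousB (@entry_continuous v x) (@entry_continuous u x))).
have Kc : compact K.
  apply: (@subclosed_compact _ _ [set x : 'rV[R]_#|T| | forall i, `[-1, 1]%classic (x ord0 i)]).
  - apply: closedI.
      by move/continuous_closedP: sumc => /(_ _ (@closed_eq _ 0)).
    by move/continuous_closedP: dotc => /(_ _ (@closed_eq _ 1)).
  - apply: (@rV_compact R _ (fun=> `[-1, 1]%classic)) => i; exact: segment_compact.
  - move=> x [_ /= x1] i; rewrite /= in_itv/= -ler_norml -(@ler_pXn2r _ 2)// ?nnegrE//.
    rewrite expr1n real_normK ?num_real// -x1 /dotp (bigD1 (enum_val i))//= /entry enum_valK.
    by rewrite expr2 lerDl sumr_ge0// => j _; rewrite -expr2 sqr_ge0.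
have normalise g : \sum_v g v = 0 -> dotp g g != 0 ->
    exists x s, [/\ K x, 0 < s, s ^+ 2 = dotp g g & forall v, g v = s * entry x v].
  move=> g0 gg; have ggp : 0 < dotp g g by rewrite lt0r gg dotp_ge0.
  pose s := Num.sqrt (dotp g g); have sp : 0 < s by rewrite sqrtr_gt0.
  have s2 : s ^+ 2 = dotp g g by rewrite sqr_sqrtr// ltW.
  pose x : 'rV[R]_#|T| := \row_i (s^-1 * g (enum_val i)).
  have xE v : entry x v = s^-1 * g v by rewrite /entry mxE enum_rankK.
  exists x, s; split=> //; last by move=> v; rewrite xE mulrA mulfV ?mul1r ?gt_eqF.
  split=> /=; first by under eq_bigr do rewrite xE; rewrite -mulr_sumr g0 mulr0.
  have -> : dotp (entry x) (entry x) = (s ^+ 2)^-1 * dotp g g.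
    rewrite /dotp mulr_sumr; apply: eq_bigr => v _; rewrite xE.
    by rewrite mulrACA -expr2 exprVn.
  by rewrite s2 mulVf.
have K0 : K !=set0.
  pose g (v : T) : R := (v == u0)%:R - (v == v0)%:R.
  have [||x [s [Kx _ _ _]]] := normalise g; last by exists x.
    by rewrite sumrB !sumr_indicator subrr.
  apply/eqP => /dotp_eq0/(_ u0)/eqP; rewrite /g eqxx (negbTE uv) subr0 oner_eq0//.
have [x] := compact_EVT_min K0 Kc (continuous_subspaceT bc); rewrite inE => -[x0 x1] xmin.
exists (entry x); split=> // g g0.
have [gg|gg] := eqVneq (dotp g g) 0; first by rewrite gg mulr0 energy_ge0.
have [y [s [Ky sp s2 gE]]] := normalise g g0 gg.
have -> : bform g g = s ^+ 2 * bform (entry y) (entry y).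
  rewrite /bform mulr_sumr; apply: eq_bigr => v _.
  have -> : wlap g v = s * wlap (entry y) v.
    by rewrite /wlap mulr_sumr; apply: eq_bigr => u _; rewrite !gE; ring.
  by rewrite gE; ring.
by rewrite -s2 mulrC ler_pM2l ?exprn_gt0// xmin// inE.
Qed.

(** The energy minus mu times the square norm is minimal at f. Its derivative
    at f in the direction h = Lf - mu f is twice the square norm of h, so h
    vanishes. *)
Lemma min_is_eigenvector f : \sum_v f v = 0 -> dotp f f = 1 ->
    (forall g, \sum_v g v = 0 -> bform f f * dotp g g <= bform g g) ->
  forall v, wlap f v = bform f f * f v.
Proof.
move=> f0 f1 fmin; set mu := bform f f in fmin *.
pose h v := wlap f v - mu * f v.
have h0 : \sum_v h v = 0 by rewrite sumrB sum_wlap -mulr_sumr f0 mulr0 subrr.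
have cross : bform f h - mu * dotp f h = dotp h h.
  rewrite /bform /dotp mulr_sumr -sumrB; apply: eq_bigr => v _; rewrite /h; ring.
suff /dotp_eq0 hv : dotp h h = 0 by move=> v; apply/eqP; rewrite -subr_eq0; apply/eqP/hv.
apply/eqP/negPn/negP => hh; have hp : 0 < dotp h h by rewrite lt0r hh dotp_ge0.
(* At f + t h, the energy minus mu times the square norm is at most 2 c t + d t^2, which is
   negative at t = - c / d. *)
set c := dotp h h in hp cross *; pose d := `|bform h h - mu * c| + 1.
have d0 : 0 < d by rewrite ltr_wpDl.
have := fmin (fun v => f v + (- (c / d)) * h v).
rewrite bformDZ dotpDZ f1 big_split/= f0 -mulr_sumr h0 mulr0 addr0 -/mu -/c => /(_ erefl) key.
have key2 : 0 <= - (c / d) * (2 * c) + (c / d) ^+ 2 * (bform h h - mu * c).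
  rewrite (_ : - (c / d) * (2 * c) = - (c / d) * (2 * (bform f h - mu * dotp f h)));
    last by rewrite cross.
  by move: key; rewrite -subr_ge0; congr (0 <= _); ring.
have : (c / d) ^+ 2 * (bform h h - mu * c) <= (c / d) ^+ 2 * d.
  rewrite ler_wpM2l ?sqr_ge0// /d; apply: le_trans (ler_norm _) _; lra.
have -> : (c / d) ^+ 2 * d = c / d * c by rewrite expr2; field; exact: lt0r_neq0.
have : 0 < c / d * c by rewrite !mulr_gt0// invr_gt0.
lra.
Qed.

(** If the minimum mu were 0, the minimizer would be constant on a connected
    graph, hence zero. *)
Lemma spectral_gap (connected : forall (S : T -> Prop) u, S u ->
    (forall u v, 0 < w u v -> S u -> S v) -> forall v, S v) :
  (exists u v : T, u != v) ->
  exists mu f, [/\ 0 < mu, exists v, f v != 0, forall v, wlap f v = mu * f v &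
    forall g, \sum_v g v = 0 -> mu * dotp g g <= bform g g].
Proof.
move=> T2; have [f [f0 f1 fmin]] := rayleigh_minimizer T2.
have [v fv] : exists v, f v != 0.
  apply: contrapT => nf; have : dotp f f = 0.
    by apply: big1 => v _; have [->|fv] := eqVneq (f v) 0; [rewrite mul0r|case: nf; exists v].
  by rewrite f1 => /eqP; rewrite oner_eq0.
exists (bform f f), f; split=> //; [|by exists v|exact: min_is_eigenvector].
rewrite lt0r energy_ge0 andbT; apply/eqP => E0.
have fc : forall u, f u = f v.
  by apply: (connected (fun u => f u = f v) v) => // x y xy <-; rewrite (energy0 E0 xy).
move: f0; under eq_bigr do rewrite fc.
rewrite sumr_const => /eqP; rewrite mulrn_eq0 (negbTE fv) orbF => /eqP.
by move=> /card0_eq/(_ v).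
Qed.

End WeightedLaplacian.

(** * The first eigenvalue of a model *)

Section Lambda1.
Context {R : realType} {Gamma : metricType R} (hG : metric_graph Gamma).
Context (V : {fset Gamma}) (hV : vertex_set V) (hs : simple_model V).
Context (hpoint : exists p q : Gamma, p <> q).

Definition adj (v u : V) : bool := `[< Defs.adjacent V (val v) (val u) >].
Definition adj_weight (v u : V) : R := (adj v u)%:R.

Lemma adj_sym v u : adj v u = adj u v.
Proof. by apply/asboolP/asboolP => /(adjacent_sym hG hV). Qed.

Lemma wlap_laplacian (f : {ffun V -> R^o}) v : wlap adj_weight f v = laplacian f v.
Proof.
rewrite ffunE big_mkcond/=; apply: eq_bigr => u _; rewrite /adj_weight /adj.
by case: asboolP => _; rewrite ?mul1r ?mul0r.
Qed.

Lemma eigenvalueP (mu : R) (f : V -> R) v0 : f v0 != 0 ->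
  (forall v, wlap adj_weight f v = mu * f v) ->
  passmx.leigenvalue (linfun (@laplacian R Gamma V)) mu.
Proof.
move=> fv0 feig; pose F : {ffun V -> R^o} := [ffun v => f v].
have Ff v : F v = f v by rewrite ffunE.
rewrite /passmx.leigenvalue /passmx.leigenspace; apply/eqP => k0.
have : F \in lker (linfun (@laplacian R Gamma V) - mu *: \1%VF).
  rewrite memv_ker add_lfunE opp_lfunE scale_lfunE id_lfunE lfunE/= subr_eq0.
  apply/eqP/ffunP => v; rewrite -wlap_laplacian (_ : wlap adj_weight F v = wlap adj_weight f v).
    by rewrite feig !ffunE.
  by apply: eq_bigr => u _; rewrite !Ff.
rewrite k0 memv0 => /eqP F0; move: fv0; rewrite -Ff F0 ffunE eqxx//.
Qed.

(** The minimum of the Rayleigh quotient is a non-zero eigenvalue, hence at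
    least [lambda1 V]. *)
Lemma lambda1_rayleigh (g : V -> R) : \sum_v g v = 0 ->
  lambda1 V * dotp g g <= bform adj_weight g g.
Proof.
move=> g0.
have w_sym u v : adj_weight u v = adj_weight v u by rewrite /adj_weight adj_sym.
have w_ge0 u v : 0 <= adj_weight u v by rewrite ler0n.
have [||mu [f [mu0 [v0 fv0] feig mug]]] := spectral_gap w_sym w_ge0.
- move=> S u0 Su0 Sadj v.
  pose S' : set Gamma := [set x | forall xV : x \in V, S [` xV]%fset].
  have fsE (u : V) (uV : val u \in V) : [` uV]%fset = u by exact: val_inj.
  suff : S' (val v) by move=> /(_ (valP v)); rewrite fsE.
  apply: (@adjacent_connected _ _ hG V hV S' (val u0) (valP u0)); last exact: valP.
    by move=> xV; rewrite fsE.
  move=> x y xy S'x yV; have /(adjacentP hG hV)[_ [c [_ xV _ _ _]]] := xy.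
  apply: (Sadj [` xV]%fset); last exact: S'x.
  by rewrite ltr0n lt0b; apply/asboolP.
- have [u [v [uV vV uv]]] := card_vertices_gt1 hG hV hs hpoint.
  by exists [` uV]%fset, [` vV]%fset; rewrite -val_eqE.
apply: le_trans (mug g g0); rewrite ler_wpM2r ?dotp_ge0//.
have muA : [set a | a != 0 /\ passmx.leigenvalue (linfun (@laplacian R Gamma V)) a] mu.
  by split; [rewrite gt_eqF|exact: eigenvalueP fv0 feig].
(* If there were no least non-zero eigenvalue, then lambda1 V would be 0. *)
rewrite /lambda1 /minimum; case: xgetP => [a _ [_ /(_ mu muA)]|_] //.
exact: ltW.
Qed.

Let dmax := max_valence Gamma.

Lemma degree_le_max_valence v : \sum_u adj_weight v u <= dmax%:R.
Proof.
rewrite /adj_weight -natr_sum ler_nat.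
apply: leq_trans (leq_trans (degree_le_valence hG hV v) _).
  rewrite -sum1_card [leqRHS]big_mkcond/=; apply: leq_sum => u _.
  by rewrite inE -/(adj v u); case: (adj v u).
by rewrite -(valence_nrays hG); exact: (valence_le_max hV).
Qed.

(** The square of g u - g v is at most twice the sum of the squares, and each
    vertex occurs in at most d_max edges; any non-zero g of mean zero will do. *)
Lemma lambda1_le_max_valence : lambda1 V <= 2 * dmax%:R.
Proof.
have [u [v [uV vV uv]]] := card_vertices_gt1 hG hV hs hpoint.
pose u' : V := [` uV]%fset; pose v' : V := [` vV]%fset.
pose g (x : V) : R := (x == u')%:R - (x == v')%:R.
have g0 : \sum_x g x = 0 by rewrite sumrB !sumr_indicator subrr.
have gp : 0 < dotp g g.
  rewrite lt0r dotp_ge0 andbT; apply/eqP => /dotp_eq0/(_ u')/eqP.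
  by rewrite /g eqxx -val_eqE/= (negbTE uv) subr0 oner_eq0.
rewrite -(ler_pM2r gp); apply: le_trans (lambda1_rayleigh g0) _.
rewrite -(@ler_pMn2r _ 2)// energyE; last by move=> x y; rewrite /adj_weight adj_sym.
have -> : 2 * dmax%:R * dotp g g *+ 2 =
    \sum_x (dmax%:R * (2 * g x ^+ 2)) + \sum_x (dmax%:R * (2 * g x ^+ 2)).
  rewrite /dotp -mulr_sumr; under [in RHS]eq_bigr do rewrite expr2.
  by rewrite -mulr_sumr mulr2n; ring.
apply: (@le_trans _ _ (\sum_x \sum_y (adj_weight x y * (2 * g x ^+ 2)) +
                       \sum_x \sum_y (adj_weight x y * (2 * g y ^+ 2)))).
  rewrite -big_split/=; apply: ler_sum => x _; rewrite -big_split/=; apply: ler_sum => y _.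
  rewrite -mulrDr ler_wpM2l ?ler0n//.
  have := sqr_ge0 (g x + g y); nra.
have half : \sum_x \sum_y (adj_weight x y * (2 * g x ^+ 2)) <= \sum_x (dmax%:R * (2 * g x ^+ 2)).
  apply: ler_sum => x _; rewrite -mulr_suml ler_wpM2r ?degree_le_max_valence// mulr_ge0 ?sqr_ge0//.
apply: lerD => //; rewrite exchange_big/=; apply: le_trans half.
by apply: ler_sum => x _; apply: ler_sum => y _; rewrite /adj_weight adj_sym.
Qed.

End Lambda1.

(** * Linear equivalence and balanced divisors *)

(** Take the largest value of f that has at most half of the points strictly
    below it; the next value has more than half of the points strictly below it,
    so less than half lie above the chosen one. *)
Lemma median (R : realDomainType) (T : finType) (f : T -> R) : exists c,
  (2 * #|[pred v | (f v < c)%R]| <= #|T|)%N /\ (2 * #|[pred v | (c < f v)%R]| <= #|T|)%N.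
Proof.
have [v0|T0] := pickP (@predT T); last first.
  by exists 0; split; rewrite eq_card0 ?muln0// => v; have := T0 v.
pose low v := (2 * #|[pred u | (f u < f v)%R]| <= #|T|)%N.
have [m _ mmin] := @arg_minP _ R T v0 predT f isT.
have lowm : low m.
  by rewrite /low eq_card0 ?muln0// => u; rewrite !inE ltNge mmin.
have [v lowv vmax] := @arg_maxP _ R T m low f lowm.
exists (f v); split=> //.
have [w0 w0v|no] := pickP [pred u | f v < f u]; last by rewrite eq_card0 ?muln0.
have [w /= vw wmin] := @arg_minP _ R T w0 [pred u | f v < f u] f w0v.
have nloww : ~~ low w by apply/negP => /vmax /=; rewrite leNgt vw.
have : (#|[pred u | (f u < f w)%R]| + #|[pred u | (f v < f u)%R]| <= #|T|)%N.
  rewrite -cardUI [X in (_ + X)%N]eq_card0 ?addn0 ?max_card// => u; rewrite !inE.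
  by apply/negP => /andP[uw vu]; have := wmin u vu; rewrite /= leNgt uw.
have arith (N a b : nat) : (N < 2 * a -> a + b <= N -> 2 * b <= N)%N by lia.
by move: nloww; rewrite /low -ltnNge; exact: arith.
Qed.

Section LinearEquivalence.
Context {R : realType} {Gamma : metricType R} (hG : metric_graph Gamma).
Implicit Types (D E : {freeg Gamma}) (f : Gamma -> R) (p x : Gamma).

Let cG : compact [set: Gamma]. Proof. by have [] := hG. Qed.

Lemma linearly_equivalentP D D' : linearly_equivalent D D' <->
  exists2 f, rational_function f & forall p, coeff p D = coeff p D' + ord f p.
Proof.
split=> [[f fR DD']|[f fR DD']]; exists f => //.
  by move=> p; rewrite -(coeff_principal_div p cG fR) -DD' coeffB addrC subrK.
apply/eqP/freeg_eqP => p; rewrite coeffB DD' (coeff_principal_div p cG fR).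
by rewrite addrC addKr.
Qed.

Lemma linearly_equivalent_deg D D' : linearly_equivalent D D' -> deg D = deg D'.
Proof.
move=> [f fR DD']; apply/eqP; rewrite -subr_eq0 -degB DD'.
by rewrite (deg_principal_div0 hG fR).
Qed.

Lemma linearly_equivalent_sym D D' : linearly_equivalent D D' -> linearly_equivalent D' D.
Proof.
move=> /linearly_equivalentP[f fR DD']; apply/linearly_equivalentP.
exists (\- f); first exact: rational_functionN.
by move=> p; rewrite ordN// DD' addrK.
Qed.

Lemma linearly_equivalent_trans D D' D'' : linearly_equivalent D D' ->
  linearly_equivalent D' D'' -> linearly_equivalent D D''.
Proof.
move=> /linearly_equivalentP[f fR DD'] /linearly_equivalentP[g gR D'D''].
apply/linearly_equivalentP; exists (f \+ g); first exact: rational_functionD.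
by move=> p; rewrite ordD// DD' D'D'' addrAC -addrA [ord f p + _]addrC.
Qed.

Lemma effectiveP D : effective D <-> forall p, 0 <= coeff p D.
Proof. by split=> /fgposP. Qed.

Lemma ord_locally_constant f p c : rational_function f ->
  (\forall q \near p, f q = c) -> ord f p = 0.
Proof.
move=> fR /nbhs_mdist[e e0 fc]; have [n [r [phi [m [cp fm ->]]]]] := ord_slopes p fR.
apply: big1 => i _; have [r0 _ _ _] := cp.1.
have [w [w0 we wr]] := pos_lt_both e0 r0.
have := fm i w ltac:(lra).
rewrite (fc p) ?mdistxx// fc; last by rewrite (star_chart_dist _ cp.1)//; lra.
move=> /eqP; rewrite eq_sym -subr_eq0 addrAC subrr add0r mulf_eq0 (gt_eqF w0) orbF.
by rewrite intr_eq0 => /eqP.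
Qed.

Definition complement_support D : set Gamma := [set p | coeff p D = 0].

Section Level.
Context (f : Gamma -> R) (fR : rational_function f) (D : {freeg Gamma}) (c : R).
Context (Deff : forall p, 0 <= coeff p D) (Eeff : forall p, 0 <= coeff p D + ord f p).

(** The effective divisor met at the level c on the way from D to D + div f. *)
Definition level_divisor : {freeg Gamma} := D + principal_div (truncate c f).

Lemma coeff_level_divisor p : coeff p level_divisor = coeff p D + ord (truncate c f) p.
Proof. by rewrite coeffD coeff_principal_div//; exact: rational_truncate. Qed.

Lemma level_divisor_effective p : 0 <= coeff p level_divisor.
Proof.
rewrite coeff_level_divisor; have [gt lt eq] := ord_truncate c p fR.
case: (ltgtP (f p) c) => h; [by rewrite lt// addr0|by rewrite gt|].
by rewrite addr_ge0// eq.
Qed.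

Lemma level_divisor_equiv : linearly_equivalent level_divisor D.
Proof.
apply/linearly_equivalentP; exists (truncate c f); first exact: rational_truncate.
exact: coeff_level_divisor.
Qed.

Lemma level_divisor_const p : complement_support level_divisor p -> f p = c ->
  coeff p D = 0 /\ \forall q \near p, f q = c.
Proof.
rewrite /complement_support/= coeff_level_divisor => Dp fp.
exact: level_locally_constant fR fp (Deff p) (Eeff p) Dp.
Qed.

(** Off the support of the level divisor, f is constant near each point of the
    level set, so that {f = c} is open and closed there. *)
Lemma connected_off_level (K : set Gamma) : connected K ->
  K `<=` complement_support level_divisor ->
  [\/ forall p, K p -> f p = c, forall p, K p -> c < f p | forall p, K p -> f p < c].
Proof.
move=> cK KW; have [fc _] := fR.
have open_side (a : bool) : open [set p | if a then c < f p else f p < c].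
  rewrite openE => p pc; have d0 : 0 < `|f p - c|.
    by rewrite normr_gt0 subr_eq0; case: a pc => /= ?; [rewrite gt_eqF|rewrite lt_eqF].
  have /continuous_mdistP/(_ p _ d0)[d dp dP] := fc.
  apply/nbhs_mdist; exists d => // q /dP.
  by case: a pc => /= pc;
    [rewrite (@gtr0_norm _ (f p - c)) ?subr_gt0//
    |rewrite (@ltr0_norm _ (f p - c)) ?subr_lt0//];
    rewrite ltr_norml => /andP[]; lra.
have [[p0 [Kp0 fp0]]|no] := pselect (exists p, K p /\ f p = c).
  apply: Or31; have : K `<=` [set p | \forall q \near p, f q = c].
    apply: (connected_subset_clopen (K := [set p | f p = c])) => //.
    - by rewrite openE => p; exact: nbhs_interior.
    - rewrite (_ : mkset _ = ~` ([set p | c < f p] `|` [set p | f p < c])).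
        by apply: open_closedC; apply: openU; [exact: (open_side true)|exact: (open_side false)].
      apply/seteqP; split=> p /=; first by move=> ->; rewrite ltxx; case.
      by case: (ltgtP (f p) c) => // h; case; [right|left].
    - apply/seteqP; split=> p [Kp pc]; split=> //; first exact: nbhs_singleton pc.
      exact: (level_divisor_const (KW p Kp) pc).2.
    - exists p0; split=> //; exact: (level_divisor_const (KW p0 Kp0) fp0).2.
  by move=> KU p /KU /nbhs_singleton.
have ne p : K p -> (c < f p) = ~~ (f p < c).
  by move=> Kp; case: (ltgtP (f p) c) => // fpc; case: no; exists p.
have [[p0 [Kp0 fp0]]|nogt] := pselect (exists p, K p /\ c < f p).
  apply: Or32; apply: (connected_subset_clopen (K := ~` [set p | f p < c])) => //.
  - exact: (open_side true).
  - by apply: open_closedC; exact: (open_side false).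
  - apply/seteqP; split=> p [Kp] /= pc; split=> //=; first by apply/negP; rewrite -ne.
    by rewrite ne//; exact/negP.
  - by exists p0.
apply: Or33 => p Kp; apply: contrapT => /negP; rewrite -ne// => pc.
by apply: nogt; exists p.
Qed.

End Level.

Context (V : {fset Gamma}).

(** This is empty if D has a chip at u, so these classes form only a partial
    equivalence relation on the vertices. *)
Definition vertex_class D (u : V) : pred V :=
  fun v => `[< connected_component (complement_support D) (val u) (val v) >].

(** What rank at least one means for a divisor class: chips can be moved to any
    given point. *)
Definition moves_everywhere D0 := forall x : Gamma,
  exists E, [/\ effective E, linearly_equivalent E D0 & 1 <= coeff x E].

(** Otherwise there is a least large class, that of u for a divisor D. Let
    E = D + div f have a chip at u. At a level of f that is a median of its values at the
    vertices, the large class of the level divisor cannot lie above or below the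
    level, so it lies on the level, inside the class of u. By minimality it
    contains u, where E then has no chip. *)
Lemma balanced_divisor (x0 : Gamma) D0 : moves_everywhere D0 -> exists D,
  [/\ effective D, linearly_equivalent D D0 &
      forall u : V, (2 * #|vertex_class D u| <= #|{: V}|)%N].
Proof.
move=> rk; apply: contrapT => nobal.
have big D : effective D -> linearly_equivalent D D0 ->
    exists u : V, (#|{: V}| < 2 * #|vertex_class D u|)%N.
  move=> De DD0; apply: contrapT => nu; apply: nobal; exists D; split=> // u.
  by rewrite leqNgt; apply/negP => h; apply: nu; exists u.
pose good n := `[< exists D (u : V), [/\ effective D, linearly_equivalent D D0,
  (#|{: V}| < 2 * #|vertex_class D u|)%N & #|vertex_class D u| = n] >].
have exgood : exists n, good n.
  have [D [De DD0 _]] := rk x0; have [u Du] := big D De DD0.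
  by exists #|vertex_class D u|; apply/asboolP; exists D, u.
have [n /asboolP[D [u [De DD0 Du un]]] nmin] := ex_minnP exgood.
have [E [Ee ED0 Eu]] := rk (val u).
have /linearly_equivalentP[f fR EE] := linearly_equivalent_trans ED0 (linearly_equivalent_sym DD0).
have [c [clow chigh]] := median (fun v : V => f (val v)).
have Deff : forall p, 0 <= coeff p D by apply/effectiveP.
have Eeff : forall p, 0 <= coeff p D + ord f p by move=> p; rewrite -EE; move: p; exact/effectiveP.
pose Dc := level_divisor f D c.
have Dce : effective Dc by apply/effectiveP => p; exact: level_divisor_effective.
have DcD0 : linearly_equivalent Dc D0.
  exact: linearly_equivalent_trans (level_divisor_equiv fR D c) DD0.
have [w bigw] := big Dc Dce DcD0.
pose K := connected_component (complement_support Dc) (val w).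
have cK : connected K by exact: component_connected.
have KW : K `<=` complement_support Dc by exact: connected_component_sub.
have absurd_card (N a b : nat) : (N < 2 * a -> a <= b -> 2 * b <= N -> False)%N by lia.
have [Kc|Kgt|Klt] := connected_off_level fR Deff Eeff cK KW; last 2 first.
- have : (#|vertex_class Dc w| <= #|[pred v : V | (c < f (val v))%R]|)%N.
    by apply: subset_leq_card; apply/fintype.subsetP => v /asboolP /Kgt.
  by move=> le; exact: absurd_card bigw le chigh.
- have : (#|vertex_class Dc w| <= #|[pred v : V | (f (val v) < c)%R]|)%N.
    by apply: subset_leq_card; apply/fintype.subsetP => v /asboolP /Klt.
  by move=> le; exact: absurd_card bigw le clow.
have KD : K `<=` complement_support D.
  by move=> p Kp; exact: (level_divisor_const fR Deff Eeff (KW p Kp) (Kc p Kp)).1.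
have absurd_sum (N a b : nat) : (N < 2 * a -> N < 2 * b -> a + b <= N -> False)%N by lia.
have [y yw yu] : exists2 y, y \in vertex_class Dc w & y \in vertex_class D u.
  have [y|no] := pickP [predI vertex_class Dc w & vertex_class D u].
    by move=> /andP[? ?]; exists y.
  have := cardUI (vertex_class Dc w) (vertex_class D u); rewrite [X in (_ + X)%N]eq_card0//.
  rewrite addn0 => sum; have := max_card [predU vertex_class Dc w & vertex_class D u].
  by rewrite sum => le; have [] := absurd_sum _ _ _ bigw Du le.
have {}yw : K (val y) by exact/asboolP.
have {}yu : connected_component (complement_support D) (val u) (val y) by exact/asboolP.
have Ku : K `<=` connected_component (complement_support D) (val u).
  rewrite (same_connected_component yu).
  exact: connected_component_max.
have sub : {subset vertex_class Dc w <= vertex_class D u}.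
  by move=> v /asboolP /Ku ?; exact/asboolP.
have uK : K (val u).
  have uDu : u \in vertex_class D u.
    apply/asboolP; apply: (connected_component_trans yu).
    exact: connected_component_sym yu.
  have subF : vertex_class Dc w \subset vertex_class D u by exact/fintype.subsetP.
  have cards : #|vertex_class Dc w| = #|vertex_class D u|.
    apply/eqP; rewrite eqn_leq subset_leq_card//= un; apply: nmin.
    by apply/asboolP; exists Dc, w.
  have eq_class := subset_cardP cards subF.
  by have /asboolP : u \in vertex_class Dc w by rewrite eq_class.
have [Du0 fu] := level_divisor_const fR Deff Eeff (KW _ uK) (Kc _ uK).
by move: Eu; rewrite EE Du0 (ord_locally_constant fR fu).
Qed.

End LinearEquivalence.

(** * Existence of divisors of rank one *)

Section Gonality.
Context {R : realType} {Gamma : metricType R} (hG : metric_graph Gamma).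
Implicit Types (D E : {freeg Gamma}) (f : Gamma -> R) (p x : Gamma).

Lemma deg_sum_dom D : deg D = \sum_(p <- dom D) coeff p D.
Proof.
by rewrite -{1}(freeg_sumE D) raddf_sum/=; apply: eq_bigr => p _; rewrite degU.
Qed.

Lemma deg_effective_ge0 D : effective D -> 0 <= deg D.
Proof. by move=> De; rewrite deg_sum_dom sumr_ge0// => p _; exact: (effectiveP _).1. Qed.

Lemma effective_point x : effective (<< 1%:Z *g x >> : {freeg Gamma}).
Proof. by apply/effectiveP => p; rewrite coeffU mul1r ler0n. Qed.

Lemma effectiveD D E : effective D -> effective E -> effective (D + E).
Proof.
by move=> /effectiveP De /effectiveP Ee; apply/effectiveP => p; rewrite coeffD addr_ge0.
Qed.

Lemma effective_remove D : effective D -> D != 0 -> exists x, effective (D - << 1%:Z *g x >>).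
Proof.
move=> /effectiveP De; rewrite -dom_eq0; case dD: (dom D) => [//|x s] _.
have xD : coeff x D != 0 by rewrite -mem_dom dD mem_head.
exists x; apply/effectiveP => p; rewrite coeffB coeffU mul1r.
by have [<-|_] := eqVneq x p; have := De x; have := De p; lia.
Qed.

Lemma effective_deg0 D : effective D -> deg D = 0 -> D = 0.
Proof.
move=> De D0; apply/eqP/negPn/negP => /(effective_remove De)[x /deg_effective_ge0].
by rewrite degB degU D0.
Qed.

Lemma effective_deg1 D : effective D -> deg D = 1 -> exists x, D = << 1%:Z *g x >>.
Proof.
move=> De D1; have [D0|/(effective_remove De)[x Dx]] := eqVneq D 0.
  by move: D1; rewrite D0 deg0.
by exists x; apply/eqP; rewrite -subr_eq0; apply/eqP/effective_deg0 => //; rewrite degB degU D1.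
Qed.

Definition rank_ge1 D := forall E, effective E -> deg E <= 1 -> linear_system (D - E) !=set0.

Lemma linearly_equivalentB D E F : linearly_equivalent D (E - F) <-> linearly_equivalent (D + F) E.
Proof. by split=> -[f fR DE]; exists f => //; rewrite -DE opprD opprK addrA// addrAC. Qed.

Lemma rank1_moves_everywhere D : rank D = 1 -> moves_everywhere D.
Proof.
(* The default value 0 of the minimum would give the rank -1. *)
rewrite /rank /minimum => rD x; move: rD; case: xgetP => [d _ [_ dmin]|_]; last by lia.
move=> d1; have {d1}d2 : d = 2 by lia.
have [F [Fe FE]] : linear_system (D - << 1%:Z *g x >>) !=set0.
  apply/set0P/eqP => no; have := dmin 1; rewrite d2 => /(_ _); apply/not_implyP; split=> //.
  by exists << 1%:Z *g x >>; [split=> //; exact: effective_point|exact: degU].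
exists (F + << 1%:Z *g x >>); split.
- exact: effectiveD Fe (effective_point x).
- exact/linearly_equivalentB.
- by rewrite coeffD coeffU eqxx mulr1 lerDr; exact: (effectiveP _).1.
Qed.

Lemma moves_everywhere_rank_ge1 (x0 : Gamma) D : moves_everywhere D -> rank_ge1 D.
Proof.
move=> mD E Ee E1.
have [x [E' E'e]] : exists x, exists2 E', effective E' & E + E' = << 1%:Z *g x >>.
  have [E0|E0] := eqVneq (deg E) 0.
    exists x0, << 1%:Z *g x0 >>; first exact: effective_point.
    by rewrite (effective_deg0 Ee E0) add0r.
  have := deg_effective_ge0 Ee => Ege0.
  have [|x ->] := effective_deg1 Ee; first by lia.
  by exists x, 0; rewrite ?addr0//; apply/effectiveP => p; rewrite coeff0.
move=> EE'; have [F [Fe FD Fx]] := mD x.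
exists (F - << 1%:Z *g x >> + E'); split.
  apply: effectiveD E'e; apply/effectiveP => p; rewrite coeffB coeffU mul1r.
  have /effectiveP Fp := Fe; have [xp|_] := eqVneq x p; last by rewrite subr0.
  by rewrite -xp; lia.
by apply/linearly_equivalentB; rewrite -EE' -addrA [E' + E]addrC subrK.
Qed.

(** Firing q up to the distance t sends one chip along each ray at q, and
    these chips stop at distance t. *)
Definition cone q (t : R) : Gamma -> R := fun y => - Num.min t (mdist q y).

Lemma cone_continuous q t : continuous (cone q t).
Proof.
apply/continuous_mdistP => p e e0; exists e => // y; apply: le_lt_trans.
rewrite /cone !minEle.
have := metric_triangle q p y; have := metric_triangle q y p; rewrite (metric_sym y p).
move: (mdist_ge0 p y); rewrite ler_norml.
by case: (leP t (mdist q p)) => ?; case: (leP t (mdist q y)) => ? ? ? ?; apply/andP; split; lra.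
Qed.

Lemma cone_slopes (q : Gamma) (t : R) y : 0 < t < chart_radius hG q ->
  (exists n r (phi : 'I_n -> R -> Gamma) (m : 'I_n -> int),
    star_chart y r phi /\ outgoing_slopes (cone q t) y r phi m) /\
  [/\ y = q -> ord (cone q t) y = - (nrays hG q)%:Z,
      y <> q -> 0 <= ord (cone q t) y &
      mdist q y = t -> ord (cone q t) y = 1].
Proof.
move=> tr; have [yq|yq] := pselect (y = q).
  rewrite yq.
  have cq : star_chart q t (@ray _ _ hG q).
    by apply: star_chart_shrink (rayP hG q).1 _; lra.
  have sl : outgoing_slopes (cone q t) q t (@ray _ _ hG q) (fun=> -1).
    move=> i s st; rewrite /cone mdistxx ray_dist; last lra.
    by rewrite !min_r; lra.
  split; first by exists (nrays hG q), t, (@ray _ _ hG q), (fun=> -1).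
  split=> [_||]; [|by []|by rewrite mdistxx => t0; exfalso; lra].
  by rewrite (ordE cq sl) sumr_const card_ord mulNrn natz.
have d0 : 0 < mdist q y by rewrite mdist_gt0; apply/eqP => h; apply: yq.
have [ty|ty] := ltP t (mdist q y).
  have cst : \forall z \near y, cone q t z = - t.
    apply/nbhs_mdist; exists (mdist q y - t); first by rewrite subr_gt0.
    move=> z yz; rewrite /cone min_l//; have := metric_triangle q z y.
    by rewrite (metric_sym z y); lra.
  have [_ _ /(_ y)[n [r [phi cy]]]] := hG.
  have sl : exists2 e, 0 < e <= r & outgoing_slopes (cone q t) y e phi (fun=> 0).
    have /nbhs_mdist[e e0 eP] := cst; have [r0 _ _ _] := cy.
    have [w [w0 we wr]] := pos_lt_both e0 r0; exists w; first by rewrite w0 ltW.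
    move=> i s sw; rewrite mul0r addr0 !eP ?mdistxx//.
    by rewrite (star_chart_dist _ cy); lra.
  have [e er sle] := sl.
  split; first by exists n, e, phi, (fun=> 0); split=> //; exact: star_chart_shrink cy er.
  have -> : ord (cone q t) y = 0 by rewrite (ordE (star_chart_shrink cy er) sle) big1.
  by split=> // h; exfalso; lra.
have [|i [s [sr yE]]] := (rayP hG q).2 y _ yq; first by lra.
have ds : mdist q y = s by rewrite yE ray_dist//; lra.
have rd u : 0 <= u < chart_radius hG q -> cone q t (ray i u) = - Num.min t u.
  by move=> ur; rewrite /cone ray_dist.
have [st|ts] := ltP s t.
  have [e [e0 es et]] := pos_lt_both (ltac:(lra) : 0 < s) (ltac:(lra) : 0 < t - s).
  have tse : s + e <= chart_radius hG q by lra.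
  have cy := interior_chart i (rayP hG q) e0 (ltW es) tse.
  have [| |sl o] := @ord_two_slopes _ _ (cone q t) (ray i) s e (-1) 1 cy.
  - by move=> u us; rewrite !rd ?min_r; lra.
  - by move=> u us; rewrite !rd ?min_r; lra.
  rewrite -yE in sl o cy.
  split.
    exists 2%N, e, (two_rays (ray i) s), (two_slopes (-1) 1).
    by split; [exact: cy.1|exact: sl].
  by split=> // [_|h]; [rewrite o; lia|exfalso; lra].
have {ts}ts : s = t by lra.
rewrite ts in sr yE ds.
have [e [e0 es et]] := pos_lt_both (ltac:(lra) : 0 < t) (ltac:(lra) : 0 < chart_radius hG q - t).
have tse : t + e <= chart_radius hG q by lra.
have cy := interior_chart i (rayP hG q) e0 (ltW es) tse.
have [| |sl o] := @ord_two_slopes _ _ (cone q t) (ray i) t e 0 1 cy.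
- by move=> u us; rewrite !rd ?min_l; lra.
- by move=> u us; rewrite !rd ?min_r; lra.
split.
  by exists 2%N, e, (two_rays (ray i) t), (two_slopes 0 1); rewrite yE; split; [exact: cy.1|].
have oy : ord (cone q t) y = 1 by rewrite yE o.
by split=> //; rewrite oy.
Qed.

Lemma cone_rational (q : Gamma) t : 0 < t < chart_radius hG q -> rational_function (cone q t).
Proof.
move=> tr; split; first exact: cone_continuous.
by move=> y; have [h _] := cone_slopes y tr.
Qed.

(** Put enough chips at the centres of finitely many charts that cover Gamma;
    a point of a chart is then reached by firing the centre of this chart. *)
Lemma exists_moves_everywhere : exists D, moves_everywhere D.
Proof.
have [cG _ _] := hG.
have [F FP] := compact_balls cG (chart_radius_gt0 hG).
pose D := \sum_(q <- F) << (nrays hG q)%:Z + 1 *g q >>.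
have coeffF q : q \in F -> coeff q D = (nrays hG q)%:Z + 1.
  move=> qF; rewrite /D raddf_sum/= (big_fsetD1 q)//= coeffU eqxx mulr1 big_seq big1 ?addr0// => p.
  by rewrite !inE => /andP[/negbTE pq _]; rewrite coeffU pq mulr0.
have De p : 0 <= coeff p D.
  by rewrite /D raddf_sum/= sumr_ge0// => q _; rewrite coeffU; case: eqP; lia.
exists D => x; have [q qF qx] := FP x.
have [xq|xq] := pselect (x = q).
  have cstR : rational_function (fun _ : Gamma => 0 : R).
    by apply: rational_function_cst => p; have [_ _] := hG; exact.
  exists D; split; first exact/effectiveP.
    apply/(linearly_equivalentP hG); exists (fun=> 0); first exact: cstR.
    move=> p; have -> : ord (fun=> 0) p = 0; last by rewrite addr0.
    by apply: (ord_locally_constant cstR) => //; exact: filterE.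
  by rewrite xq coeffF//; lia.
have tr : 0 < mdist q x < chart_radius hG q.
  by rewrite qx mdist_gt0 andbT; apply/eqP => h; apply: xq.
have fR := cone_rational tr.
have coeffE p :
    coeff p (D + principal_div (cone q (mdist q x))) = coeff p D + ord (cone q (mdist q x)) p.
  by rewrite coeffD coeff_principal_div.
exists (D + principal_div (cone q (mdist q x))); split.
- apply/effectiveP => p; rewrite coeffE; have [_ [oq onq _]] := cone_slopes p tr.
  have [pq|pq] := pselect (p = q); last by rewrite addr_ge0// onq.
  by rewrite oq// pq coeffF//; lia.
- by apply/(linearly_equivalentP hG); exists (cone q (mdist q x)).
- rewrite coeffE; have [_ [_ _ ->//]] := cone_slopes x tr.
  by have := De x; lia.
Qed.

Lemma minimum_int (A : set int) d : A d -> (forall a, A a -> 0 <= a) ->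
  exists2 m, minimum 0 A = m & A m /\ forall a, A a -> m <= a.
Proof.
move=> Ad A0.
pose good n := `[< A n%:Z >].
have ex : exists n, good n.
  by have := A0 _ Ad; case: d Ad => // n An _; exists n; exact/asboolP.
have [n /asboolP An nmin] := ex_minnP ex.
have nle a : A a -> n%:Z <= a.
  move=> Aa; have := A0 _ Aa; case: a Aa => // k Ak _.
  by rewrite lez_nat; apply: nmin; exact/asboolP.
exists n%:Z => //; apply: xget_unique; first by split.
by move=> y [Ay ymin]; apply/eqP; rewrite eq_le nle//= ymin.
Qed.

Lemma rank_ge1_deg_ge0 D : rank_ge1 D -> 0 <= deg D.
Proof.
move=> /(_ 0)[||E [Ee]]; rewrite ?deg0//.
  by apply/effectiveP => p; rewrite coeff0.
by rewrite subr0 => /(linearly_equivalent_deg hG) <-; exact: deg_effective_ge0.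
Qed.

(** A divisor of least degree among those of rank at least one: if its rank were
    at least two, removing a point would leave a divisor of rank at least one
    and of smaller degree. *)
Lemma exists_rank1 (x0 : Gamma) : exists D : {freeg Gamma}, rank D = 1.
Proof.
have [D0 /(moves_everywhere_rank_ge1 x0) rD0] := exists_moves_everywhere.
have [_ _ [[D rD <-] dmin]] : exists2 m, minimum 0 [set deg D | D in rank_ge1] = m &
    [set deg D | D in rank_ge1] m /\ forall a, [set deg D | D in rank_ge1] a -> m <= a.
  apply: minimum_int; first by exists D0.
  by move=> _ [D rD <-]; exact: rank_ge1_deg_ge0.
have x0e := effective_point x0; exists D.
suff -> : rank D = 2 - 1 by [].
congr (_ - 1).
set A := [set deg E | E in _].
have A_ge2 d : A d -> 2 <= d.
  move=> [E [Ee noE] <-]; rewrite leNgt; apply/negP => E2.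
  by have /set0P := rD E Ee ltac:(lia); rewrite noE eqxx.
have A2 : A 2.
  apply: contrapT => no2.
  have ne2 E : effective E -> deg E = 2 -> linear_system (D - E) !=set0.
    by move=> Ee E2; apply/set0P/eqP => noE; apply: no2; exists E.
  have rD' : rank_ge1 (D - << 1%:Z *g x0 >>).
    move=> E Ee E1; rewrite -addrA -opprD; have xEe := effectiveD x0e Ee.
    have degxE : deg (<< 1%:Z *g x0 >> + E) = 1 + deg E by rewrite degD degU.
    have [E1'|E1'] := eqVneq (deg E) 1; first by apply: ne2; rewrite // degxE E1'.
    by apply: rD; rewrite // degxE; lia.
  have := dmin (deg (D - << 1%:Z *g x0 >>)); rewrite degB degU => h.
  have : deg D <= deg D - 1 by apply: h; exists (D - << 1%:Z *g x0 >>) => //; rewrite degB degU.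
  lia.
apply: xget_unique; first by split.
by move=> d [Ad dmin']; apply/eqP; rewrite eq_le A_ge2// dmin'.
Qed.

(** Degrees of divisors of rank one are not negative, so they have a least
    element. *)
Lemma div_gonality_attained (x0 : Gamma) : exists D : {freeg Gamma},
  [/\ moves_everywhere D, effective D & deg D = div_gonality Gamma].
Proof.
have [D0 rD0] := exists_rank1 x0.
have [m mE [[D rD Dm] _]] : exists2 m, div_gonality Gamma = m &
    [set deg D | D in [set D : {freeg Gamma} | rank D = 1]] m /\
    forall a, [set deg D | D in [set D : {freeg Gamma} | rank D = 1]] a -> m <= a.
  apply: minimum_int; first by exists D0.
  move=> _ [D rD <-]; have [E [Ee ED _]] := rank1_moves_everywhere rD x0.
  by rewrite -(linearly_equivalent_deg hG ED); exact: deg_effective_ge0.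
have [E [Ee ED _]] := rank1_moves_everywhere rD x0; exists E; split=> //.
  move=> x; have [E' [E'e E'D E'x]] := rank1_moves_everywhere rD x; exists E'; split=> //.
  exact: (linearly_equivalent_trans hG E'D (linearly_equivalent_sym hG ED)).
by rewrite (linearly_equivalent_deg hG ED) Dm mE.
Qed.

End Gonality.

(** * Cutting a model along a balanced divisor *)

(** Take a union of classes of least size among those with at least a quarter
    of the elements. If it had more than half of them, then removing one of its
    classes, which is at most half, leaves less than a quarter; so this class
    alone has more than a quarter, against minimality. *)
Lemma balanced_union (T : finType) (cls : rel T) :
  symmetric cls -> transitive cls -> (forall u, 2 * #|cls u| <= #|T|)%N ->
  (#|T| <= 4 * #|[pred u | cls u u]|)%N ->
  exists A : {set T}, [/\ forall u, u \in A -> cls u u,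
    forall u v, cls u v -> (u \in A) = (v \in A),
    (#|T| <= 4 * #|A|)%N & (2 * #|A| <= #|T|)%N].
Proof.
move=> clsC clsT half quarter.
pose good (A : {set T}) := [&& [forall u in A, cls u u],
  [forall u in A, forall v, cls u v ==> (v \in A)] & (#|T| <= 4 * #|A|)%N].
have [|A /and3P[/forall_inP AU /forall_inP Acl Abig] Amin] :=
  @arg_minnP _ [set u | cls u u]%SET good (fun A => #|A|).
  apply/and3P; split.
  - by apply/forall_inP => u; rewrite inE.
  - apply/forall_inP => u _; apply/forallP => v; apply/implyP => uv.
    by rewrite inE; apply: (@clsT u v v); rewrite // clsC.
  - by rewrite cardsE.
have {}Acl u v : u \in A -> cls u v -> v \in A.
  by move=> uA uv; have /forallP/(_ v)/implyP := Acl u uA; exact.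
exists A; split=> // [u v uv|].
  by apply/idP/idP => h; [exact: Acl uv|apply: Acl h _; rewrite clsC].
rewrite leqNgt; apply/negP => Alarge.
have [x xA] : exists x, x \in A.
  by apply/set0Pn; apply: contraTneq Alarge => ->; rewrite cards0 muln0.
have xx := AU x xA.
pose C := [set v | cls x v]%SET.
have cardC : #|C| = #|cls x| by rewrite cardsE.
have CA : C \subset A by apply/fintype.subsetP => v; rewrite inE; exact: Acl.
have xC : x \in C by rewrite inE.
have Cgood : (#|T| <= 4 * #|C|)%N -> good C.
  move=> Cbig; apply/and3P; split=> //.
    apply/forall_inP => u; rewrite inE => xu; by apply: (@clsT x u u); rewrite // clsC.
  apply/forall_inP => u; rewrite inE => xu; apply/forallP => v; apply/implyP => uv.
  by rewrite inE; exact: (@clsT u x v).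
have Dgood : (#|T| <= 4 * #|A :\: C|)%N -> good (A :\: C)%SET.
  move=> Dbig; apply/and3P; split=> //.
    by apply/forall_inP => u; rewrite inE => /andP[_]; exact: AU.
  apply/forall_inP => u; rewrite !inE => /andP[xu uA]; apply/forallP => v; apply/implyP => uv.
  rewrite !inE (Acl u v uA uv) andbT; apply: contra xu => xv.
  by apply: (@clsT v x u); rewrite // clsC.
have cardA : (#|A| = #|C| + #|A :\: C|)%N by rewrite -(cardsID C A) (finset.setIidPr CA).
have C0 : (0 < #|C|)%N by apply/card_gt0P; exists x.
have arith (n a c d : nat) : (n < 2 * a -> 2 * c <= n -> 0 < c -> a = c + d ->
   (n <= 4 * d -> a <= d) -> (n <= 4 * c -> a <= c) -> False)%N by lia.
apply: (arith _ _ _ _ Alarge _ C0 cardA).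
- by rewrite cardC.
- by move=> /Dgood; exact: Amin.
- by move=> /Cgood; exact: Amin.
Qed.

Section Cut.
Context {R : realType} {Gamma : metricType R} (hG : metric_graph Gamma).
Context (V : {fset Gamma}) (hV : vertex_set V) (hs : simple_model V).
Context (D : {freeg Gamma}) (De : effective D).

Local Notation component V := (connected_component (~` [set` V])).
Let dmax := max_valence Gamma.

Lemma size_dom_le_deg : (size (dom D))%:Z <= deg D.
Proof.
rewrite deg_sum_dom -sum1_size -natz natr_sum big_seq [leRHS]big_seq.
apply: ler_sum => p pD; have := (effectiveP D).1 De p; rewrite mem_dom in pD; lia.
Qed.

Lemma card_support_vertices : (#|[pred v : V | coeff (val v) D != 0]| <= size (dom D))%N.
Proof.
rewrite cardE -(size_map val); apply: uniq_leq_size.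
  by rewrite map_inj_uniq ?enum_uniq//; exact: val_inj.
by move=> y /mapP[v]; rewrite mem_enum /= => vD ->; rewrite mem_dom.
Qed.

(** Every adjacent pair of vertices that D separates is attributed to a point
    of the support of D on the edge between them: a vertex receives the pairs
    in which it occurs, any other point the two orientations of the edge that
    contains it. *)
Definition charged (p : Gamma) (u v : V) : bool := adj u v &&
  if p \in V then (val u == p) || (val v == p)
  else `[< closure (component V p) (val u) /\ closure (component V p) (val v) >].

Lemma degree_le_max_valence_nat (u : V) : (\sum_v adj u v <= dmax)%N.
Proof.
by have := degree_le_max_valence hG hV u; rewrite /adj_weight -natr_sum ler_nat.
Qed.

Lemma sum_charged p : (\sum_u \sum_v charged p u v <= 2 * dmax)%N.
Proof.
have [pV|pV] := boolP (p \in V).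
  pose p' : V := [` pV]%fset.
  apply: (@leq_trans (\sum_u \sum_v ((u == p') * adj u v + (v == p') * adj v u))%N).
    apply: leq_sum => u _; apply: leq_sum => v _; rewrite /charged pV.
    rewrite -(inj_eq val_inj u) -(inj_eq val_inj v) /= (adj_sym hG hV v u).
    by case: (adj u v); case: (_ == p); case: (_ == p).
  have one : (\sum_u \sum_v ((u == p') * adj u v) <= dmax)%N.
    rewrite (bigD1 p')//= eqxx [X in (_ + X)%N]big1 ?addn0; last first.
      by move=> u /negbTE ->; rewrite big1// => v _; rewrite mul0n.
    by under eq_bigr do rewrite mul1n; exact: degree_le_max_valence_nat.
  under eq_bigr do rewrite big_split/=; rewrite big_split/= mul2n -addnn.
  by apply: leq_add => //; rewrite exchange_big.
have [u0 [v0 [u0V v0V uv0 Cu0 Cv0]]] := component_two_ends hG hV hs pV.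
pose u1 : V := [` u0V]%fset; pose v1 : V := [` v0V]%fset.
apply: (@leq_trans 2); last first.
  rewrite leq_pmulr//; apply: leq_trans (valence_le_max hV p).
  by rewrite (valence_nrays hG) (nrays_off_vertex_set hG hV pV).
apply: (@leq_trans (\sum_u \sum_v ((u == u1) * (v == v1) + (u == v1) * (v == u1)))%N).
  apply: leq_sum => u _; apply: leq_sum => v _; rewrite /charged (negbTE pV).
  have [uv|//] := boolP (adj u v); case: asboolP => //= -[Cu Cv].
  have uv' : val u != val v by have /asboolP/(adjacentP hG hV)[] := uv.
  have end2 (w : V) : closure (component V p) (val w) -> w = u1 \/ w = v1.
    move=> Cw; have [wu|wu] := eqVneq (val w) u0; [left|right]; apply: val_inj => //=.
    by apply: (closure_ends_uniq hG hV u0V (valP w) v0V Cu0 Cw Cv0 wu); rewrite eq_sym.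
  case: (end2 u Cu) (end2 v Cv) uv' => -> [] ->; rewrite !eqxx//= => _.
    by rewrite ?mul1n ?addn_gt0 ?orbT.
have ind (a b : V) : (\sum_u \sum_v ((u == a) * (v == b)) = 1)%N.
  rewrite (bigD1 a)//= eqxx [X in (_ + X)%N]big1 ?addn0; last first.
    by move=> u /negbTE ->; rewrite big1// => v _; rewrite mul0n.
  rewrite (bigD1 b)//= eqxx big1 ?addn0// => v /negbTE ->; by rewrite muln0.
by under eq_bigr do rewrite big_split/=; rewrite big_split/= !ind.
Qed.

Lemma crossing_charged (u v : V) : adj u v -> ~~ vertex_class D u v ->
  exists2 p, p \in dom D & charged p u v.
Proof.
move=> uv nuv; have /asboolP/(adjacentP hG hV)[neq [c [cV uV vV Cu Cv]]] := uv.
have [[p [pD Cp]]|no] := pselect (exists p, p \in dom D /\ closure (component V c) p).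
  exists p => //; rewrite /charged uv/=; have [pV|pV] := boolP (p \in V).
    have [//|up] := eqVneq (val u) p.
    have -> : p = val v.
      by apply: (closure_ends_uniq hG hV uV pV vV Cu Cp Cv); rewrite // eq_sym.
    by rewrite eqxx.
  have Cp' := closure_component hG Cp pV.
  by apply/asboolP; rewrite -(same_connected_component Cp').
case/negP: nuv; apply/asboolP.
have : closure (component V c) (val v) by [].
apply: connected_component_max => //.
  move=> p Cp; apply/eqP/negPn/negP => pD; apply: no; exists p; split=> //.
  by rewrite mem_dom.
exact/connected_closure/component_connected.
Qed.

Lemma sum_crossing :
  (\sum_(u : V) \sum_(v : V) (adj u v && ~~ vertex_class D u v)
     <= size (dom D) * (2 * dmax))%N.
Proof.
apply: (@leq_trans (\sum_(p <- dom D) \sum_u \sum_v charged p u v)%N); last first.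
  rewrite -sum1_size big_distrl/=; apply: leq_sum => p _; rewrite mul1n.
  exact: sum_charged.
rewrite [leqRHS]exchange_big/=; apply: leq_sum => u _.
rewrite [leqRHS]exchange_big/=; apply: leq_sum => v _.
have [uv|//] := boolP (adj u v); have [//|nuv] := boolP (vertex_class D u v).
have [p pD pc] := crossing_charged uv nuv.
by rewrite (big_rem p)//= pc.
Qed.

End Cut.

(** * The lower bound *)

Section Bound.
Context {R : realType} {Gamma : metricType R} (hG : metric_graph Gamma).
Context (V : {fset Gamma}) (hV : vertex_set V) (hs : simple_model V).
Context (hpoint : exists p q : Gamma, p <> q).
Context (D : {freeg Gamma}) (De : effective D).
Context (Dbal : forall u : V, (2 * #|vertex_class D u| <= #|{: V}|)%N).

Let dmax := max_valence Gamma.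
Let cls : rel V := vertex_class D.

Lemma cls_sym : symmetric cls.
Proof. by move=> u v; apply/asboolP/asboolP; exact: connected_component_sym. Qed.

Lemma cls_trans : transitive cls.
Proof.
move=> v u w /asboolP uv /asboolP vw; apply/asboolP.
exact: connected_component_trans uv vw.
Qed.

Lemma cls_refl u : cls u u = (coeff (val u) D == 0).
Proof.
apply/asboolP/eqP => [/connected_component_sub//|uD].
exact: connected_component_refl.
Qed.

Lemma card_off_support :
  (#|{: V}| = #|[pred u | cls u u]| + #|[pred u : V | coeff (val u) D != 0]|)%N.
Proof.
rewrite -(cardC [pred u | cls u u]); congr (_ + _)%N; apply: eq_card => u.
by rewrite !inE cls_refl.
Qed.

(** The test function has the value b on A, - a on the b remaining vertices off
    the support, and 0 on the support. It has mean zero and square norm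
    ab (a + b), it is constant on each component, and it differs by at most
    a + b along an edge between two components. *)
Lemma cut_bound (A : {set V}) (b : nat) : (forall u, u \in A -> cls u u) ->
  (forall u v, cls u v -> (u \in A) = (v \in A)) ->
  #|[pred u | cls u u]| = (#|A| + b)%N ->
  (#|A|%:R * b%:R * (#|A| + b)%:R * lambda1 V <=
    (#|A| + b)%:R ^+ 2 * dmax%:R * (deg D)%:~R :> R).
Proof.
move=> AU Acl cardU; set a := #|A|.
pose g (u : V) : R := if u \in A then b%:R else if cls u u then - a%:R else 0.
have cardB : #|[pred u | (u \notin A) && cls u u]| = b.
  have : #|[pred u | cls u u]| = (#|A| + #|[pred u | (u \notin A) && cls u u]|)%N.
    rewrite -(cardID (mem A) [pred u | cls u u]); congr (_ + _)%N; apply: eq_card => u; rewrite !inE.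
      by apply: andb_idl; exact: AU.
  by rewrite cardU => /addnI <-.
have sumg (F : R -> R) : F 0 = 0 -> \sum_u F (g u) = a%:R * F b%:R + b%:R * F (- a%:R).
  move=> F0; rewrite (bigID (mem A))/=; congr (_ + _).
    rewrite (eq_bigr (fun=> F b%:R)) => [|u uA]; last by rewrite /g uA.
    by rewrite sumr_const mulr_natl.
  rewrite (eq_bigr (fun u => if cls u u then F (- a%:R) else 0)) => [|u uA]; last first.
    by rewrite /g (negbTE uA); case: ifP.
  by rewrite -big_mkcondr/= sumr_const cardB mulr_natl.
have g0 : \sum_u g u = 0 by rewrite (sumg id)//; ring.
have gg : dotp g g = a%:R * b%:R * (a + b)%:R.
  by rewrite /dotp (sumg (fun x => x * x)) ?mul0r// natrD; ring.
have grange u : - a%:R <= g u <= b%:R.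
  have a0 : 0 <= a%:R :> R by []; have b0 : 0 <= b%:R :> R by [].
  by rewrite /g; case: ifP => _; [|case: ifP => _]; lra.
have energy : bform (@adj_weight R Gamma V) g g *+ 2 <=
    (a + b)%:R ^+ 2 * (2 * (dmax%:R * (deg D)%:~R)).
  rewrite energyE; last by move=> x y; rewrite /adj_weight (adj_sym hG hV).
  apply: (@le_trans _ _ ((a + b)%:R ^+ 2 *
      (\sum_(u : V) \sum_(v : V) (adj u v && ~~ cls u v))%N%:R)).
    rewrite natr_sum mulr_sumr; apply: ler_sum => u _.
    rewrite natr_sum mulr_sumr; apply: ler_sum => v _.
    rewrite /adj_weight; case: (adj u v); last by rewrite mul0r mulr0.
    have [uv|nuv] := boolP (cls u v).
      have uu : cls u u by apply: (@cls_trans v u u); rewrite // cls_sym.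
      have vv : cls v v by apply: (@cls_trans u v v); rewrite // cls_sym.
      by rewrite /g (Acl u v uv) uu vv subrr expr0n mulr0 mulr0.
    rewrite mul1r mulr1 -ler_sqrt ?exprn_ge0// !sqrtr_sqr (ger0_norm (ler0n _ _)) natrD.
    by have := grange u; have := grange v; rewrite ler_norml; lra.
  rewrite ler_wpM2l ?exprn_ge0//.
  apply: (@le_trans _ _ (size (dom D) * (2 * dmax))%N%:R).
    by rewrite ler_nat; exact: (sum_crossing hG hV hs D).
  have dD : (size (dom D))%:R <= (deg D)%:~R :> R.
    by rewrite -[leLHS]/((size (dom D))%:Z%:~R) ler_int; exact: size_dom_le_deg.
  have d0 : 0 <= dmax%:R :> R by [].
  by rewrite !natrM; nra.
have := lambda1_rayleigh hG hV hs hpoint g0; rewrite gg.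
by move: energy; rewrite mulr2n; lra.
Qed.

(** With at least n / 12 vertices in the support the degree is at least n / 12.
    Otherwise A has between n / 4 and n / 2 elements, so that b is at least
    5n / 12, and n (a + b) is at most 24 ab. *)
Lemma gonality_bound_of_balanced :
  #|{: V}|%:R * lambda1 V <= 24 * dmax%:R * (deg D)%:~R :> R.
Proof.
set n := #|{: V}|; pose s := #|[pred u : V | coeff (val u) D != 0]|.
have dmax0 : 0 <= dmax%:R :> R by [].
have sd : s%:R <= (deg D)%:~R :> R.
  apply: (@le_trans _ _ (size (dom D))%:R); first by rewrite ler_nat; exact: card_support_vertices.
  by rewrite -[leLHS]/((size (dom D))%:Z%:~R) ler_int; exact: size_dom_le_deg.
have [ns|sn] := leqP n (12 * s).
  have l2 := lambda1_le_max_valence hG hV hs hpoint; rewrite -/dmax in l2.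
  have n0 : 0 <= n%:R :> R by [].
  have {}ns : n%:R <= 12 * s%:R :> R by rewrite -natrM ler_nat.
  have : n%:R * lambda1 V <= n%:R * (2 * dmax%:R) by rewrite ler_wpM2l.
  nra.
have cardU := card_off_support; rewrite -/n -/s in cardU.
have quarterU (N U k : nat) : (N = U + k -> 12 * k < N -> N <= 4 * U)%N by lia.
have [A [AU Acl quarter half]] :=
  balanced_union cls_sym cls_trans Dbal (quarterU _ _ _ cardU sn).
rewrite -/n in quarter half.
have AleU : (#|A| <= #|[pred u | cls u u]|)%N by apply: subset_leq_card; apply/fintype.subsetP.
pose b := (#|[pred u | cls u u]| - #|A|)%N.
have bE : #|[pred u | cls u u]| = (#|A| + b)%N by rewrite subnKC.
have cut := cut_bound AU Acl bE.
set a := #|A| in cut quarter half bE AleU *.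
have arith (N U k c e : nat) :
    (N = U + k -> 12 * k < N -> U = c + e -> N <= 4 * c -> 2 * c <= N ->
    [/\ 0 < c, 0 < e & N * (c + e) <= 24 * (c * e)])%N by move=> *; split; nia.
have [a0 b0 comb] := arith _ _ _ _ _ cardU sn bE quarter half.
have d0 : 0 <= (deg D)%:~R :> R by rewrite ler0z; exact: deg_effective_ge0.
have [l0|l0] := lerP (lambda1 V) 0.
  apply: (@le_trans _ _ 0); first by rewrite mulr_ge0_le0.
  by rewrite !mulr_ge0.
have ab0 : 0 < (a + b)%:R :> R by rewrite ltr0n addn_gt0 a0.
have {}cut : a%:R * b%:R * lambda1 V <= (a + b)%:R * dmax%:R * (deg D)%:~R.
  by rewrite -(ler_pM2l ab0); move: cut; rewrite expr2; lra.
have {}comb : n%:R * (a + b)%:R <= 24 * (a%:R * b%:R) :> R by rewrite -!natrM ler_nat.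
rewrite -(ler_pM2l ab0).
have : n%:R * (a + b)%:R * lambda1 V <= 24 * (a%:R * b%:R) * lambda1 V.
  by rewrite ler_wpM2r// ltW.
lra.
Qed.

End Bound.

Local Close Scope classical_set_scope.

Theorem theorem5p4 (R : realType) (Gamma : metricType R) (V : {fset Gamma})
    (hGamma : metric_graph Gamma) (hpoint : exists p q : Gamma, p <> q)
    (hV : vertex_set V) (hsimple : simple_model V) :
  (div_gonality Gamma)%:~R >=
    (#|` V|)%:R * lambda1 V / (24%:R * (max_valence Gamma)%:R) :> R.
Proof.
have [x0 _] := hpoint.
have [D0 [mD0 D0e <-]] := div_gonality_attained hGamma x0.
have [D [De DD0 Dbal]] := balanced_divisor hGamma V x0 mD0.
rewrite -(linearly_equivalent_deg hGamma DD0) cardfE.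
have := gonality_bound_of_balanced hGamma hV hsimple hpoint De Dbal.
(* For d_max = 0 the bound is a division by zero, whose value is 0. *)
have [->|dpos] := posnP (max_valence Gamma).
  by move=> _; rewrite mulr0 invr0 mulr0 ler0z; exact: deg_effective_ge0.
move=> bound; rewrite ler_pdivrMr ?mulr_gt0 ?ltr0n//.
by rewrite [leRHS]mulrC.
Qed.
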